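(* Let $T=(V,E)$ be a tree with $n$ nodes rooted at $v_1$ with leaf set $Y$, let $w\le u$ be real edge vectors, $c>0$ an edge cost vector, and $D\in\mathbb{R}$. The problem (MCSPIT$_{BH}$) can be solved in $O(n\log n)$ time; that is, there is an algorithm (Algorithm 2: binary search over the sorted distinct edge costs $C_j$, evaluating the shortest root-leaf distance of the vector that raises to $u(e)$ every edge with $c(e)\le C_j$) that in $O(n\log n)$ time either correctly reports infeasibility or outputs an optimal solution $\bar w$ and the optimal value.
   Context: For each leaf $t_k$, $P_k$ is the edge set of the path from $v_1$ to $t_k$; $f(P_k):=\sum_{e\in P_k}f(e)$. $H(a,b)=1$ if $a\neq b$ and $0$ otherwise. The problem (MCSPIT$_{BH}$) is: minimize $M(\bar w):=\max_{e\in E}c(e)H(\bar w(e),w(e))$ over $\bar w:E\to\mathbb{R}$ subject to $\bar w(P_k)\ge D$ for all leaves $t_k\in Y$ and $w(e)\le\bar w(e)\le u(e)$ for all $e\in E$. *)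

(* Defs.v *)
From mathcomp Require Import all_boot all_order all_algebra.
From mathcomp Require Import boolp classical_sets reals constructive_ereal.

Set Implicit Arguments.
Unset Strict Implicit.
Unset Printing Implicit Defensive.

Import Order.TTheory GRing.Theory Num.Theory.
Local Open Scope ring_scope.

(* Real RAM: unbounded memory made of arrays of naturals and arrays of reals,
   indirect addressing through array indices, unit-cost arithmetic and
   comparisons.  Integer arithmetic is limited to addition, truncated
   subtraction and halving; there is no conversion from reals to integers
   (no floor), so reals influence control flow only through comparisons.
   Scalars are cells of arrays; array names are fixed by the program. *)

Inductive iexpr : Type :=
| IConst of nat
| ILoad of nat & iexpr
| IAdd of iexpr & iexpr
| ISub of iexpr & iexpr
| IHalf of iexpr.

Inductive rexpr : Type :=
| RConst of nat
| RLoad of nat & iexpr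
| RAdd of rexpr & rexpr
| RSub of rexpr & rexpr
| RMul of rexpr & rexpr
| RDiv of rexpr & rexpr.

Inductive bexpr : Type :=
| BIeq of iexpr & iexpr
| BIle of iexpr & iexpr
| BRle of rexpr & rexpr
| BNot of bexpr
| BAnd of bexpr & bexpr.

Inductive cmd : Type :=
| CSkip
| CIStore of nat & iexpr & iexpr
| CRStore of nat & iexpr & rexpr
| CSeq of cmd & cmd
| CIf of bexpr & cmd & cmd
| CWhile of bexpr & cmd.

Record state (R : realType) : Type := State {
  imem : nat -> nat -> nat;
  rmem : nat -> nat -> R }.

Definition upd (A : Type) (f : nat -> nat -> A) (a i : nat) (x : A) :
    nat -> nat -> A :=
  fun b j => if (b == a) && (j == i) then x else f b j.

Fixpoint ieval (R : realType) (s : state R) (e : iexpr) : nat :=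
  match e with
  | IConst k => k
  | ILoad a i => imem s a (ieval s i)
  | IAdd x y => (ieval s x + ieval s y)%N
  | ISub x y => (ieval s x - ieval s y)%N
  | IHalf x => (ieval s x)./2
  end.

Fixpoint reval (R : realType) (s : state R) (e : rexpr) : R :=
  match e with
  | RConst k => k%:R
  | RLoad a i => rmem s a (ieval s i)
  | RAdd x y => reval s x + reval s y
  | RSub x y => reval s x - reval s y
  | RMul x y => reval s x * reval s y
  | RDiv x y => reval s x / reval s y
  end.

Fixpoint beval (R : realType) (s : state R) (b : bexpr) : bool :=
  match b with
  | BIeq x y => ieval s x == ieval s y
  | BIle x y => (ieval s x <= ieval s y)%N
  | BRle x y => reval s x <= reval s y
  | BNot x => ~~ beval s x
  | BAnd x y => beval s x && beval s y
  end.

(* Evaluating an expression costs one step per node of its syntax tree. *)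

Fixpoint icost (e : iexpr) : nat :=
  match e with
  | IConst _ => 1
  | ILoad _ i => (icost i).+1
  | IAdd x y | ISub x y => (icost x + icost y).+1
  | IHalf x => (icost x).+1
  end.

Fixpoint rcost (e : rexpr) : nat :=
  match e with
  | RConst _ => 1
  | RLoad _ i => (icost i).+1
  | RAdd x y | RSub x y | RMul x y | RDiv x y => (rcost x + rcost y).+1
  end.

Fixpoint bcost (b : bexpr) : nat :=
  match b with
  | BIeq x y | BIle x y => (icost x + icost y).+1
  | BRle x y => (rcost x + rcost y).+1
  | BNot x => (bcost x).+1
  | BAnd x y => (bcost x + bcost y).+1
  end.

(* [exec p s t s']: started in [s], [p] halts in [s'] after [t] steps. *)
Inductive exec (R : realType) : cmd -> state R -> nat -> state R -> Prop :=
| ExecSkip s : exec CSkip s 1 s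
| ExecIStore a i e s :
    exec (CIStore a i e) s (icost i + icost e).+1
      (State (upd (imem s) a (ieval s i) (ieval s e)) (rmem s))
| ExecRStore a i e s :
    exec (CRStore a i e) s (icost i + rcost e).+1
      (State (imem s) (upd (rmem s) a (ieval s i) (reval s e)))
| ExecSeq p q s t1 s1 t2 s2 :
    exec p s t1 s1 -> exec q s1 t2 s2 -> exec (CSeq p q) s (t1 + t2)%N s2
| ExecIfTrue b p q s t s' :
    beval s b -> exec p s t s' -> exec (CIf b p q) s (bcost b + t).+1 s'
| ExecIfFalse b p q s t s' :
    ~~ beval s b -> exec q s t s' -> exec (CIf b p q) s (bcost b + t).+1 s'
| ExecWhileFalse b p s :
    ~~ beval s b -> exec (CWhile b p) s (bcost b).+1 s
| ExecWhileTrue b p s t1 s1 t2 s2 :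
    beval s b -> exec p s t1 s1 -> exec (CWhile b p) s1 t2 s2 ->
    exec (CWhile b p) s (bcost b + t1 + t2).+1 s2.

(* The floor of the base-2 logarithm gives the same class, since
   n * floor (log2 n) <= n * log2 n <= 2 * n * floor (log2 n) for n >= 2. *)
Definition is_O_nlogn (T : nat -> nat) : Prop :=
  exists K N : nat, forall n, (N <= n)%N -> (T n <= K * (n * trunc_log 2 n))%N.

(* A graph with vertices 'I_n.+1 and [m] edges given in arbitrary order as an
   unoriented edge list. *)
Definition edge_list (n m : nat) : Type := 'I_m -> 'I_n.+1 * 'I_n.+1.

Definition joins (n m : nat) (E : edge_list n m) (e : 'I_m) (x y : 'I_n.+1) :
    bool :=
  (E e == (x, y)) || (E e == (y, x)).

Definition adj (n m : nat) (E : edge_list n m) : rel 'I_n.+1 :=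
  fun x y => [exists e, joins E e x y].

Definition simple_graph (n m : nat) (E : edge_list n m) : Prop :=
  (forall e x, ~~ joins E e x x) /\
  (forall e e' x y, joins E e x y -> joins E e' x y -> e = e').

(* Walking back and forth along an edge is a [ucycle] of size 2. *)
Definition acyclic (n m : nat) (E : edge_list n m) : Prop :=
  forall p : seq 'I_n.+1, ucycle (adj E) p -> (size p <= 2)%N.

Definition is_tree (n m : nat) (E : edge_list n m) : Prop :=
  [/\ simple_graph E, forall x y, connect (adj E) x y & acyclic E].

(* The root v_1. *)
Definition root (n : nat) : 'I_n.+1 := ord0.

Definition leaves (n m : nat) (E : edge_list n m) : {set 'I_n.+1} :=
  [set t | (t != root n) && (#|[set e | [exists y, joins E e t y]]| == 1)%N].

Definition is_root_path (n m : nat) (E : edge_list n m) (t : 'I_n.+1)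
    (p : seq 'I_n.+1) : Prop :=
  [/\ path (adj E) (root n) p, uniq (root n :: p) & last (root n) p = t].

(* Vertices after the root on the path to [t], unique when [E] is a tree. *)
Definition root_path (n m : nat) (E : edge_list n m) (t : 'I_n.+1) :
    seq 'I_n.+1 :=
  xget [::] (is_root_path E t).

Definition path_edges (n m : nat) (E : edge_list n m) (t : 'I_n.+1) :
    {set 'I_m} :=
  [set e | has (fun xy => joins E e xy.1 xy.2)
             (zip (root n :: root_path E t) (root_path E t))].

Record instance (R : realType) (n m : nat) : Type := Instance {
  edges : edge_list n m;
  w : 'I_m -> R;
  u : 'I_m -> R;
  c : 'I_m -> R;
  D : R }.

Definition valid (R : realType) (n m : nat) (I : instance R n m) : Prop :=
  [/\ is_tree (edges I), forall e, w I e <= u I e & forall e, 0 < c I e].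

Definition path_weight (R : realType) (n m : nat) (I : instance R n m)
    (f : 'I_m -> R) (t : 'I_n.+1) : R :=
  \sum_(e in path_edges (edges I) t) f e.

Definition feasible (R : realType) (n m : nat) (I : instance R n m)
    (wb : 'I_m -> R) : Prop :=
  (forall t, t \in leaves (edges I) -> D I <= path_weight I wb t) /\
  (forall e, w I e <= wb e <= u I e).

Definition hamming (R : realType) (a b : R) : R := (a != b)%:R.

(* All terms are nonnegative for positive costs, so the default 0 only matters
   for a tree without edges. *)
Definition M (R : realType) (n m : nat) (I : instance R n m)
    (wb : 'I_m -> R) : R :=
  \big[Num.max/0]_(e < m) (c I e * hamming (wb e) (w I e)).

Definition optimal (R : realType) (n m : nat) (I : instance R n m)
    (wb : 'I_m -> R) : Prop :=
  feasible I wb /\ forall wb', feasible I wb' -> M I wb <= M I wb'.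

(* [None] reports infeasibility. *)
Definition output (R : realType) (m : nat) : Type := option (('I_m -> R) * R).

Definition correct (R : realType) (n m : nat) (I : instance R n m)
    (o : output R m) : Prop :=
  match o with
  | None => forall wb, ~ feasible I wb
  | Some (wb, z) => optimal I wb /\ z = M I wb
  end.

(* +oo when there is no leaf, i.e. for the one-vertex tree. *)
Definition shortest_distance (R : realType) (n m : nat) (I : instance R n m)
    (f : 'I_m -> R) : \bar R :=
  \big[Order.min/+oo%E]_(t in leaves (edges I)) (path_weight I f t)%:E.

Definition reaches (R : realType) (n m : nat) (I : instance R n m)
    (f : 'I_m -> R) : bool :=
  ((D I)%:E <= shortest_distance I f)%E.

Definition sorted_costs (R : realType) (n m : nat) (I : instance R n m) :
    seq R :=
  sort <=%R (undup [seq c I e | e <- enum 'I_m]).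

Definition cost_at (R : realType) (n m : nat) (I : instance R n m) (j : nat) :
    R :=
  nth 0 (sorted_costs I) j.

Definition raised (R : realType) (n m : nat) (I : instance R n m) (j : nat) :
    'I_m -> R :=
  fun e => if c I e <= cost_at I j then u I e else w I e.

(* The interval [lo, hi] shrinks at each call, so [fuel >= hi - lo] suffices
   to reach [lo = hi]. *)
Fixpoint binary_search (R : realType) (n m : nat) (I : instance R n m)
    (fuel lo hi : nat) : nat :=
  if fuel is fuel'.+1 then
    if (lo < hi)%N then
      let mid := (lo + hi)./2 in
      if reaches I (raised I mid) then binary_search I fuel' lo mid
      else binary_search I fuel' mid.+1 hi
    else lo
  else lo.

Definition algorithm2 (R : realType) (n m : nat) (I : instance R n m) :
    output R m :=
  if reaches I (w I) then Some (w I, 0)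
  else if ~~ reaches I (u I) then None
  else
    let k := size (sorted_costs I) in
    let j := binary_search I k 0 k.-1 in
    Some (raised I j, cost_at I j).

Definition mem_of (m : nat) (A : Type) (x0 : A) (f : 'I_m -> A) (i : nat) : A :=
  if insub i is Some e then f e else x0.

(* Integer arrays: 0 = [numbers of vertices and of edges], 1 and 2 = endpoints
   of the edges.  Real arrays: 0 = [D], 1 = w, 2 = u, 3 = c.  Everything else
   is zero. *)
Definition input_state (R : realType) (n m : nat) (I : instance R n m) :
    state R :=
  State
    (fun a i => match a with
       | 0 => nth 0 [:: n.+1; m] i
       | 1 => mem_of 0 (fun e => nat_of_ord (edges I e).1) i
       | 2 => mem_of 0 (fun e => nat_of_ord (edges I e).2) i
       | _ => 0
       end)%N
    (fun a i => match a with
       | 0%N => nth 0 [:: D I] i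
       | 1%N => mem_of 0 (w I) i
       | 2%N => mem_of 0 (u I) i
       | 3%N => mem_of 0 (c I) i
       | _ => 0
       end).

(* Integer array 3 holds the feasibility flag, real arrays 4 and 5 the
   solution and the value. *)
Definition output_in (R : realType) (m : nat) (s : state R) (o : output R m) :
    Prop :=
  match o with
  | None => imem s 3 0 = 0%N
  | Some (wb, z) =>
      [/\ imem s 3 0 = 1%N, forall e : 'I_m, rmem s 4 e = wb e & rmem s 5 0 = z]
  end.

(* Main.v *)
Require Import Defs.
From mathcomp Require Import all_boot all_order all_algebra.
From mathcomp Require Import boolp classical_sets reals constructive_ereal zify.

(** For a threshold [C], let [raise_upto C] raise to [u] every edge of cost at
    most [C].  A feasible vector of value below [C] only changes edges cheaper
    than [C], so it lies below [raise_upto C'] for the largest cost [C' < C]; hence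
    the least cost [C] for which [raise_upto C] keeps all root-leaf distances at
    least [D] is the optimal value, and it is attained because an edge of cost
    [C] must really be changed.

    On the machine, the tree is rooted by repeatedly removing a leaf: keeping for
    every vertex its degree and the sum of the indices of its incident edges, the
    only edge left at a leaf is this sum, so no adjacency lists are needed.  The
    reverse of the removal order visits parents before children and gives every
    feasibility test in linear time.  The costs are merge-sorted bottom-up and the
    threshold is found by binary search, with duplicates left in place. *)

Set Implicit Arguments.
Unset Strict Implicit.
Unset Printing Implicit Defensive.

Import Order.TTheory GRing.Theory Num.Theory.

(* [all_algebra] shadows it by the roots of a polynomial. *)
Local Notation root := Defs.root.

(** * Rooted trees *)

(** The search of [algorithm2] runs over distinct costs and that of the machine over the sorted
    array of all edge costs, so their indices do not match. The two are compared through
    [threshold], a property of a real number that mentions no index and holds of at most one number.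
    For the same reason sorting can be specified by the set of values that it keeps. Acyclicity
    makes root paths unique, so every edge has a child end, and the child ends are exactly the
    non-root vertices. Degrees, leaves and the progress of the removal are all expressed through
    this bijection. Time is bounded from above with generous constants; the real content of each
    bound is the number of iterations of a loop. *)

Lemma mem_zip (S T : eqType) (p : seq S) (q : seq T) x y :
  (x, y) \in zip p q -> x \in p /\ y \in q.
Proof.
elim: p q => [|a p IHp] [|b q] //=; rewrite !inE => /orP[/eqP[-> ->]|/IHp[-> ->]].
  by rewrite !eqxx.
by rewrite !orbT.
Qed.

Section Tree.
Variables (n m : nat) (E : edge_list n m).

Lemma joins_sym e x y : joins E e x y = joins E e y x.
Proof. by rewrite /joins orbC. Qed.

Lemma adj_sym : symmetric (adj E).
Proof. by move=> x y; apply: eq_existsb => e; rewrite joins_sym. Qed.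

(* If two simple paths leave [x] through distinct neighbours, their ends can be
   joined off [x], closing a cycle of length at least 3. *)
Lemma acyclic_path_uniq (x : 'I_n.+1) p q : acyclic E ->
  path (adj E) x p -> uniq (x :: p) -> path (adj E) x q -> uniq (x :: q) ->
  last x p = last x q -> p = q.
Proof.
move=> acE; elim: p x q => [|a p IHp] x [|b q] //.
- by move=> _ _ _ /andP[xq _] /= lq; case/negP: xq; rewrite lq; apply: mem_last.
- by move=> _ /andP[xp _] _ _ /= lp; case/negP: xp; rewrite -lp; apply: mem_last.
move=> /andP[xa ap] /andP[xap uap] /andP[xb bq] /andP[xbq ubq] /= lpq.
have [eab|nab] := eqVneq a b.
  by subst b; congr (_ :: _); exact: (IHp a q).
pose off : rel 'I_n.+1 := fun y z => [&& adj E y z, y != x & z != x].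
have off_sym : connect_sym off.
  apply: sym_connect_sym => y z.
  by rewrite /off adj_sym; congr (_ && _); rewrite andbC.
have off_path y r : path (adj E) y r -> x \notin y :: r -> connect off y (last y r).
  elim: r y => [|z r IHr] y //= /andP[yz zr] xyzr.
  apply: connect_trans (IHr z zr _).
    apply: connect1; rewrite /off yz /=.
    by move: xyzr; rewrite !inE !negb_or => /and3P[xy xz _]; rewrite !(eq_sym _ x) xy xz.
  by move: xyzr; rewrite [x \in _]inE negb_or => /andP[].
have /connectP[r0 ar0 br0] : connect off a b.
  apply: connect_trans (off_path _ _ ap xap) _.
  by rewrite lpq off_sym; apply: off_path.
have [r [ar ur lr]] : exists r, [/\ path off a r, uniq (a :: r) & last a r = b].
  by case/shortenP: ar0 br0 => r ar ur _ ->; exists r.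
have xr : x \notin a :: r.
  rewrite inE negb_or; move: xap; rewrite inE negb_or => /andP[-> _] /=.
  apply/negP => /(nthP x)[i ir ri].
  have := pathP x ar _ ir; rewrite ri /off => /and3P[_ _].
  by rewrite eqxx.
have : ucycle (adj E) (x :: a :: r).
  apply/andP; split; last by rewrite /= in ur *; rewrite xr.
  rewrite /= xa /= rcons_path lr adj_sym xb andbT.
  by apply: sub_path ar => y z /and3P[].
move/acE; case: r {ar ur xr} lr => //= lr; first by rewrite lr eqxx in nab.
Qed.

Hypothesis treeE : is_tree E.
Let simpleE : simple_graph E. Proof. by case: treeE. Qed.
Let connE x y : connect (adj E) x y. Proof. by case: treeE. Qed.
Let acyclicE : acyclic E. Proof. by case: treeE. Qed.

Lemma root_pathP t : is_root_path E t (root_path E t).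
Proof.
apply: (@xgetPex _ _ (is_root_path E t)).
have /connectP[p pp lp] := connE (root n) t.
by case/shortenP: pp lp => q pq uq _ lq; exists q; split.
Qed.

Lemma root_path_uniq t p : is_root_path E t p -> root_path E t = p.
Proof.
have [p1 u1 l1] := root_pathP t; case=> p2 u2 l2.
by apply: acyclic_path_uniq acyclicE p1 u1 p2 u2 _; rewrite l1.
Qed.

Lemma root_path_root : root_path E (root n) = [::].
Proof. by apply: root_path_uniq; split. Qed.

Lemma root_path_inj : injective (root_path E).
Proof.
move=> x y exy; have [_ _ <-] := root_pathP x; have [_ _ <-] := root_pathP y.
by rewrite exy.
Qed.

(** If [y] lies on the path to [x], the part of that path from [y] on closes up along the edge into
    a cycle, which has size at most 2, so [x] directly follows [y]. Otherwise the path to [x]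
    extends by [y]. *)
Lemma adj_root_path x y : adj E x y ->
  root_path E x = rcons (root_path E y) x \/ root_path E y = rcons (root_path E x) y.
Proof.
move=> xy; have [px ux lx] := root_pathP x.
have nxy : x != y.
  apply/eqP=> exy; move: xy; rewrite exy => /existsP[e].
  by case: simpleE => /(_ e y)/negP.
case yin: (y \in root n :: root_path E x); [left|right]; last first.
  apply: root_path_uniq; split; last by rewrite last_rcons.
    by rewrite rcons_path px lx xy.
  by rewrite -rcons_cons rcons_uniq yin ux.
move: px ux lx; case/splitPl: yin => p1 p2 ly.
rewrite cat_path ly last_cat ly => /andP[pp1 pp2] u12 lx.
have yp2 : uniq (y :: p2).
  move: u12; rewrite -cat_cons cat_uniq => /and3P[u1 /hasPn d12 u2].
  rewrite /= u2 andbT; apply/negP => /d12; case/negP.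
  by rewrite /= -ly; apply: mem_last.
have -> : root_path E y = p1.
  apply: root_path_uniq; split=> //.
  by move: u12; rewrite -cat_cons cat_uniq => /and3P[].
rewrite -cats1; congr cat.
have : ucycle (adj E) (y :: p2).
  by apply/andP; split => //=; rewrite rcons_path pp2 lx xy.
move/acyclicE; case: p2 lx {pp2 yp2 u12} => [|z [|]] //= lx; last by rewrite lx.
by rewrite lx eqxx in nxy.
Qed.

(** Orientation by depth: by [adj_root_path] the depths of the two ends differ by exactly one, so
    the comparison never meets a tie. *)
Definition child e :=
  if size (root_path E (E e).1) < size (root_path E (E e).2) then (E e).2 else (E e).1.
Definition parent e :=
  if size (root_path E (E e).1) < size (root_path E (E e).2) then (E e).1 else (E e).2.

Lemma child_parentE e : E e = (child e, parent e) \/ E e = (parent e, child e).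
Proof. by rewrite /child /parent; case: (E e) => x y /=; case: ifP; [right|left]. Qed.

Lemma joins_child e : joins E e (child e) (parent e).
Proof. by rewrite /joins; case: (child_parentE e) => ->; rewrite eqxx ?orbT. Qed.

Lemma joins_childP e x y : joins E e x y ->
  (x = child e /\ y = parent e) \/ (y = child e /\ x = parent e).
Proof.
by rewrite /joins; case: (child_parentE e) => -> /orP[] /eqP[<- <-]; auto.
Qed.

Lemma root_path_child e : root_path E (child e) = rcons (root_path E (parent e)) (child e).
Proof.
have : adj E (E e).1 (E e).2.
  by apply/existsP; exists e; rewrite /joins -surjective_pairing eqxx.
rewrite /child /parent => /adj_root_path[] h.
  by rewrite (_ : (_ < _) = false) // h size_rcons ltnNge leqnSn.
by rewrite (_ : (_ < _) = true) // h size_rcons ltnSn.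
Qed.

Lemma child_neq_root e : child e != root n.
Proof.
apply/eqP => h; have := root_path_child e.
by rewrite h root_path_root; case: (root_path E (parent e)).
Qed.

Lemma child_inj : injective child.
Proof.
move=> e e' h; have /rcons_inj[/root_path_inj hp _] :
    rcons (root_path E (parent e)) (child e) = rcons (root_path E (parent e')) (child e').
  by rewrite -!root_path_child h.
case: simpleE => _; apply; first exact: joins_child.
by rewrite h hp; exact: joins_child.
Qed.

Lemma child_surj v : v != root n -> exists e, child e = v.
Proof.
move=> vr; have := root_pathP v.
case/lastP: (root_path E v) => [|q v']; first by case=> _ _ /esym/eqP; rewrite (negPf vr).
case=> pq uq; rewrite last_rcons => ev; rewrite {v'}ev in pq uq.
move: (pq); rewrite rcons_path => /andP[pq' /existsP[e je]].
have eq_q : root_path E (last (root n) q) = q.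
  by apply: root_path_uniq; split=> //; move: uq; rewrite -rcons_cons rcons_uniq => /andP[].
have eq_v : root_path E v = rcons q v by apply: root_path_uniq; split; rewrite ?last_rcons.
exists e; case: (joins_childP je) => [[h1 h2]|[-> _]] //.
have := root_path_child e; rewrite -h1 -h2 eq_q eq_v => /(congr1 size).
rewrite !size_rcons; lia.
Qed.

Lemma tree_edge_count : m = n.
Proof.
have : #|codom child| = #|predC1 (root n)|.
  apply: eq_card => v; rewrite !inE; apply/codomP/idP => [[e ->]|/child_surj[e <-]].
    exact: child_neq_root.
  by exists e.
by rewrite card_codom ?card_ord ?cardC1 ?card_ord; last exact: child_inj.
Qed.

Definition depth v := size (root_path E v).

Lemma depth_child e : depth (child e) = (depth (parent e)).+1.
Proof. by rewrite /depth root_path_child size_rcons. Qed.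

Lemma child_neq_parent e : child e != parent e.
Proof. by apply/eqP => h; have := depth_child e; rewrite h; lia. Qed.

Lemma path_edges_root : path_edges E (root n) = finset.set0.
Proof. by apply/setP=> e; rewrite /path_edges root_path_root !inE. Qed.

Lemma path_edges_child e :
  path_edges E (child e) = (e |: path_edges E (parent e))%SET.
Proof.
apply/setP=> e'; rewrite /path_edges root_path_child !inE.
have zip_step r p (v : 'I_n.+1) :
    zip (r :: rcons p v) (rcons p v) = rcons (zip (r :: p) p) (last r p, v).
  by elim: p r => //= a p IHp r; rewrite -IHp.
rewrite zip_step; have [_ _ ->] := root_pathP (parent e).
rewrite has_rcons /=; congr (_ || _); apply/idP/eqP => [|->]; last first.
  by rewrite joins_sym joins_child.
rewrite joins_sym; case: simpleE => _ h je'; apply: h je' _; exact: joins_child.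
Qed.

Lemma path_edges_parent e : e \notin path_edges E (parent e).
Proof.
rewrite inE; apply/hasPn => -[x y] xy /=; apply/negP => je.
have [_] := root_pathP (child e).
rewrite root_path_child -rcons_cons rcons_uniq => /andP[/negP h _] _; apply: h.
have [hx hy] := mem_zip xy.
by case: (joins_childP je) => -[<- _] //; rewrite inE hy orbT.
Qed.

(** The degree in the form that the machine accumulates, one unit per endpoint. It agrees with the
    number of incident edges because the two ends of an edge differ. *)
Lemma leafE t : (t \in leaves E) =
  (t != root n) && ((\sum_e ((child e == t) + (parent e == t)) == 1)%N).
Proof.
rewrite inE; congr (_ && (_ == _)); rewrite -sum1_card big_mkcond /=.
apply: eq_bigr => e _; rewrite inE.
have nct := child_neq_parent e.
have -> : [exists y, joins E e t y] = (child e == t) || (parent e == t).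
  apply/existsP/orP => [[y /joins_childP[[-> _]|[_ ->]]]|[] /eqP <-].
  - by left.
  - by right.
  - by exists (parent e); exact: joins_child.
  - by exists (child e); rewrite joins_sym; exact: joins_child.
case: (eqVneq (child e) t) nct => [<-|_ _]; last by case: (_ == t).
by rewrite eq_sym => /negPf->.
Qed.
End Tree.

(** * Optimality of the threshold *)

Section Algorithm.
Local Open Scope ring_scope.
Variables (R : realType) (n m : nat) (I : instance R n m).

Lemma reachesP f :
  reflect (forall t, t \in leaves (edges I) -> D I <= path_weight I f t) (reaches I f).
Proof.
apply: (iffP (bigmin_geP _ _ _ _)) => [[_ h] t /h|h]; first by rewrite lee_fin.
by split=> [|t /h]; rewrite ?leey // lee_fin.
Qed.

Lemma reaches_mono f g : (forall e, f e <= g e) -> reaches I f -> reaches I g.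
Proof.
move=> fg /reachesP h; apply/reachesP => t /h /le_trans; apply.
by apply: ler_sum => e _.
Qed.

Lemma eq_reaches f g : f =1 g -> reaches I f = reaches I g.
Proof.
by move=> fg; apply/idP/idP; apply: reaches_mono => e; rewrite fg.
Qed.

(** Indexed by a real threshold, unlike [raised], to be meaningful for any array of costs;
    [raised I j] is the case [C = cost_at I j] by conversion. *)
Definition raise_upto (C : R) (e : 'I_m) : R := if c I e <= C then u I e else w I e.

Hypothesis validI : valid I.
Let le_wu e : w I e <= u I e. Proof. by case: validI. Qed.
Let c_gt0 e : 0 < c I e. Proof. by case: validI. Qed.

Lemma raise_upto_mono C C' e : C <= C' -> raise_upto C e <= raise_upto C' e.
Proof.
move=> CC'; rewrite /raise_upto; case: ifP => [/le_trans->//|_].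
by case: ifP.
Qed.

Lemma reaches_raise_mono C C' : C <= C' ->
  reaches I (raise_upto C) -> reaches I (raise_upto C').
Proof. by move=> CC'; apply: reaches_mono => e; exact: raise_upto_mono. Qed.

(** Costs are positive, so the machine can test [w] itself by the common routine with threshold
    0. *)
Lemma raise_upto0 : raise_upto 0 =1 w I.
Proof. by move=> e; rewrite /raise_upto leNgt c_gt0. Qed.

(** The largest cost raises every edge. Without edges, [u] and [w] coincide. *)
Lemma reaches_u_raise : (forall e, ~~ reaches I (raise_upto (c I e))) ->
  ~~ reaches I (w I) -> ~~ reaches I (u I).
Proof.
move=> nr nw; have [e0|] := pickP (@predT 'I_m); last first.
  by move=> no_e; rewrite -(@eq_reaches (w I)) // => e; have := no_e e.
have [e _ emax] := @arg_maxP _ _ _ e0 predT (c I) isT.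
move=> _; rewrite -(@eq_reaches (raise_upto (c I e))) // => e'.
by rewrite /raise_upto (emax e' isT : c I e' <= c I e).
Qed.

Lemma M_eq0 f : f =1 w I -> M I f = 0.
Proof.
move=> fw; rewrite /M big1_idem //= => [|e _]; first exact: maxxx.
by rewrite fw /hamming eqxx mulr0.
Qed.

(** A changed edge contributes its full cost to [M], so edges of cost at least [C] keep their
    weight. *)
Lemma M_lt_le_raise C wb : (forall e, w I e <= wb e <= u I e) -> M I wb < C ->
  forall e, wb e <= if c I e < C then u I e else w I e.
Proof.
move=> bnd lt e; have /andP[_ wbu] := bnd e; case: ifPn => // ; rewrite -leNgt => Ce.
have : c I e * hamming (wb e) (w I e) < C.
  by move: lt => /bigmax_ltP[_]; apply.
rewrite /hamming; have [->|_] := eqVneq; first by [].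
by rewrite mulr1 => /(le_lt_trans Ce); rewrite ltxx.
Qed.

Lemma bounded_raise C e : w I e <= raise_upto C e <= u I e.
Proof. by rewrite /raise_upto; case: ifP; rewrite lexx le_wu. Qed.

(** The optimal value when [w] itself fails, described so that any correct search, with or without
    duplicates, can be seen to find it. *)
Definition threshold C := [/\ ~~ reaches I (w I), exists e, C = c I e,
  reaches I (raise_upto C) & forall e, c I e < C -> ~~ reaches I (raise_upto (c I e))].

Lemma threshold_uniq C C' : threshold C -> threshold C' -> C = C'.
Proof.
move=> [_ [e eC] r h] [_ [e' eC'] r' h']; apply/le_anti/andP; split; rewrite leNgt; apply/negP.
  by rewrite eC' => /h; rewrite -eC' r'.
by rewrite eC => /h'; rewrite -eC r.
Qed.

Lemma threshold_minimal C f : threshold C ->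
  (forall e, f e <= if c I e < C then u I e else w I e) -> ~~ reaches I f.
Proof.
move=> [nw _ _ min] le_f.
(* With no cost below [C] the bound on [f] is [w], which fails; otherwise the largest such cost
   dominates [f]. *)
have [[e0 e0C]|] := pselect (exists e, c I e < C); last first.
  move=> no; apply: contra nw; apply: reaches_mono => e; apply: le_trans (le_f e) _.
  by case: ifP => // eC; case: no; exists e.
have [e eC emax] := @arg_maxP _ _ _ e0 (fun e => c I e < C) (c I) e0C.
apply: contra (min e eC); apply: reaches_mono => e'; apply: le_trans (le_f e') _.
rewrite /raise_upto; case: ifPn => [e'C|_].
  by rewrite (emax e' e'C : c I e' <= c I e).
by case: ifP.
Qed.

Lemma threshold_M C : threshold C -> M I (raise_upto C) = C.
Proof.
move=> thC; have [nw [e0 eC] rC _] := thC.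
apply/le_anti/andP; split.
  apply/bigmax_leP; split=> [|e _]; first by rewrite eC ltW.
  rewrite /hamming /raise_upto; case: ifPn => [leC|_].
    by case: (_ != _); rewrite ?mulr1 ?mulr0 // eC ltW.
  by rewrite eqxx mulr0 eC ltW.
rewrite leNgt; apply/negP => /(M_lt_le_raise (bounded_raise C))/(threshold_minimal thC).
by rewrite rC.
Qed.

Lemma threshold_optimal C : threshold C -> optimal I (raise_upto C).
Proof.
move=> thC; have [_ _ rC _] := thC; split.
  by split; [exact/reachesP|exact: bounded_raise].
move=> wb [/reachesP rwb bnd]; rewrite threshold_M // leNgt; apply/negP.
by move=> /(M_lt_le_raise bnd)/(threshold_minimal thC); rewrite rwb.
Qed.

Lemma mem_sorted_costs x : reflect (exists e, x = c I e) (x \in sorted_costs I).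
Proof.
rewrite mem_sort mem_undup; apply: (iffP mapP) => [[e _ ->]|[e ->]]; exists e => //.
by rewrite mem_enum.
Qed.

Lemma cost_at_mono i j : (i <= j < size (sorted_costs I))%N -> cost_at I i <= cost_at I j.
Proof.
move=> /andP[ij js]; apply: (sorted_leq_nth le_trans lexx) => //.
- exact/sort_sorted/le_total.
- by rewrite inE (leq_ltn_trans ij).
Qed.

Lemma binary_searchP fuel lo hi : (lo <= hi)%N -> (hi - lo <= fuel)%N ->
  (hi < size (sorted_costs I))%N -> reaches I (raised I hi) ->
  (forall i, (i < lo)%N -> ~~ reaches I (raised I i)) ->
  let j := binary_search I fuel lo hi in
  [/\ (j <= hi)%N, reaches I (raised I j) & forall i, (i < j)%N -> ~~ reaches I (raised I i)].
Proof.
elim: fuel lo hi => [|fuel IH] lo hi lohi hf hk rhi nlo /=.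
  have e : lo = hi by lia.
  by subst lo; split.
case: ltnP => [lt|ge]; last first.
  have e : lo = hi by lia.
  by subst lo; split.
case: ifPn => rmid.
  have [|||||h1 h2 h3] := IH lo (lo + hi)./2 => //; try lia.
  by split=> //; lia.
apply: IH => //; try lia.
(* Failure at the midpoint passes down to every smaller threshold. *)
move=> i ilo; apply: contra rmid; apply: reaches_raise_mono.
by apply: cost_at_mono; lia.
Qed.

Lemma algorithm2P :
  [\/ reaches I (w I) /\ algorithm2 I = Some (w I, 0),
      [/\ ~~ reaches I (w I), forall e, ~~ reaches I (raise_upto (c I e)) &
          algorithm2 I = None] |
      exists2 C, threshold C & algorithm2 I = Some (raise_upto C, C)].
Proof.
rewrite /algorithm2; case: ifPn => [rw|nw]; first by constructor 1.
case: ifPn => [nu|]; [constructor 2; split=> // e|rewrite negbK => ru; constructor 3].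
  apply: contra nu; apply: reaches_mono => e'.
  by have /andP[_] := bounded_raise (c I e) e'.
set k := size _; set j := binary_search _ _ _ _; exists (cost_at I j) => //.
(* Makes [k.-1] a genuine index: without costs there are no edges, and [w] would reach [D] as [u]
   does. *)
have k_gt0 : (0 < k)%N.
  rewrite lt0n; apply/eqP => /size0nil s0.
  move: nw; rewrite (@eq_reaches _ (u I)) ?ru // => e.
  have : c I e \in sorted_costs I by apply/mem_sorted_costs; exists e.
  by rewrite s0.
have cost_nth e : exists2 i, (i < k)%N & cost_at I i = c I e.
  have /(nthP 0)[i ik <-] : c I e \in sorted_costs I by apply/mem_sorted_costs; exists e.
  by exists i.
have [|||||jk rj minj] := @binary_searchP k 0 k.-1 => //; try lia.
  rewrite (@eq_reaches _ (u I)) // => e; rewrite /raised.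
  by have [i ik <-] := cost_nth e; rewrite cost_at_mono // prednK // leqnn andbT -ltnS prednK.
split=> //.
  by apply/mem_sorted_costs/mem_nth; rewrite -/k; lia.
move=> e; have [i ik <-] := cost_nth e => ij; apply: minj.
rewrite ltnNge; apply: contraL ij => ji; rewrite -leNgt cost_at_mono //.
by rewrite ji.
Qed.

Lemma algorithm2_correct : correct I (algorithm2 I).
Proof.
case: algorithm2P => [[rw ->]|[nw nr ->]|[C thC ->]] /=.
- split; last by rewrite M_eq0.
  split; first by split; [exact/reachesP|move=> e; rewrite lexx le_wu].
  by move=> wb _; rewrite M_eq0 //; exact: bigmax_ge_id.
- move=> wb [/reachesP rwb bnd]; have /negP := reaches_u_raise nr nw; apply.
  by apply: reaches_mono rwb => e; have /andP[] := bnd e.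
- by split; [exact: threshold_optimal|rewrite threshold_M].
Qed.
End Algorithm.

(** * Weakest preconditions with time bounds *)

Section Logic.
Variable R : realType.
Implicit Types (p q : cmd) (s : state R) (Q : state R -> Prop).

Definition wp p s (t : nat) Q : Prop :=
  exists t' s', [/\ exec p s t' s', t' <= t & Q s'].

Lemma wp_weaken p s t t' Q Q' :
  wp p s t Q -> t <= t' -> (forall s', Q s' -> Q' s') -> wp p s t' Q'.
Proof.
move=> [t0 [s0 [ex tt q]]] ltt qq; exists t0, s0; split=> //; last exact: qq.
exact: leq_trans ltt.
Qed.

Lemma wp_seq p q s t1 t2 Q :
  wp p s t1 (fun s1 => wp q s1 t2 Q) -> wp (CSeq p q) s (t1 + t2) Q.
Proof.
move=> [t' [s' [ep lt [t'' [s'' [eq lt' q']]]]]]; exists (t' + t''), s''.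
by split=> //; [exact: ExecSeq ep eq|exact: leq_add].
Qed.

Lemma wp_seq_le p q s t1 t2 t Q :
  wp p s t1 (fun s1 => wp q s1 t2 Q) -> t1 + t2 <= t -> wp (CSeq p q) s t Q.
Proof. by move=> h lt; apply: wp_weaken (wp_seq h) lt _. Qed.

Lemma wp_if b p q s t Q : (beval s b -> wp p s t Q) -> (~~ beval s b -> wp q s t Q) ->
  wp (CIf b p q) s (bcost b + t).+1 Q.
Proof.
move=> hp hq; case: (boolP (beval s b)) => hb.
  have [t' [s' [ex lt q']]] := hp hb; exists (bcost b + t').+1, s'; split=> //.
    exact: ExecIfTrue.
  by rewrite ltnS leq_add2l.
have [t' [s' [ex lt q']]] := hq hb; exists (bcost b + t').+1, s'; split=> //.
  exact: ExecIfFalse.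
by rewrite ltnS leq_add2l.
Qed.

(* [Inv k s]: the invariant holds in [s] and at most [k] iterations remain. *)
Lemma wp_while (Inv : nat -> state R -> Prop) b p t k s :
  (forall k s, Inv k s -> beval s b -> exists2 k', k' < k & wp p s t (Inv k')) ->
  Inv k s ->
  wp (CWhile b p) s (k * (bcost b + t).+1 + (bcost b).+1)
    (fun s' => exists2 k', Inv k' s' & ~~ beval s' b).
Proof.
move=> step; elim/ltn_ind: k s => k IH s inv.
case: (boolP (beval s b)) => hb; last first.
  exists (bcost b).+1, s; split; [exact: ExecWhileFalse|lia|by exists k].
have [k' lk [t1 [s1 [e1 l1 inv1]]]] := step _ _ inv hb.
have [t2 [s2 [e2 l2 q2]]] := IH _ lk _ inv1.
exists (bcost b + t1 + t2).+1, s2; split=> //; first exact: ExecWhileTrue hb e1 e2.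
have : k'.+1 * (bcost b + t).+1 <= k * (bcost b + t).+1 by rewrite leq_mul2r lk orbT.
rewrite mulSn; lia.
Qed.

Fixpoint straight p : bool :=
  match p with
  | CSeq p q | CIf _ p q => straight p && straight q
  | CWhile _ _ => false
  | _ => true
  end.

(** An upper bound that charges both branches of a conditional. The 0 for a loop is a dummy,
    excluded by [straight]. *)
Fixpoint straight_cost p : nat :=
  match p with
  | CSkip => 1
  | CIStore _ i e => (icost i + icost e).+1
  | CRStore _ i e => (icost i + rcost e).+1
  | CSeq p q => straight_cost p + straight_cost q
  | CIf b p q => (bcost b + (straight_cost p + straight_cost q)).+1
  | CWhile _ _ => 0
  end.

(* Stores introduce a name for the new memory, so that unfolding [straight_wp]
   does not duplicate the history of the memory at every load. *)
Fixpoint straight_wp p s Q : Prop :=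
  match p with
  | CSkip => Q s
  | CIStore a i e =>
      forall f, f = upd (imem s) a (ieval s i) (ieval s e) -> Q (State f (rmem s))
  | CRStore a i e =>
      forall f, f = upd (rmem s) a (ieval s i) (reval s e) -> Q (State (imem s) f)
  | CSeq p q => straight_wp p s (fun s1 => straight_wp q s1 Q)
  | CIf b p q => (beval s b -> straight_wp p s Q) /\ (~~ beval s b -> straight_wp q s Q)
  | CWhile _ _ => False
  end.

Lemma wp_straight p s t Q : straight p -> straight_cost p <= t ->
  straight_wp p s Q -> wp p s t Q.
Proof.
move=> + lt + ; suff h : straight p -> straight_wp p s Q -> wp p s (straight_cost p) Q.
  by move=> sp /(h sp) hp; apply: wp_weaken hp lt _.
elim: p s Q {t lt} => [|a i e|a i e|p IHp q IHq|b p IHp q IHq|b p IHp] s Q //=.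
- by move=> _ qs; exists 1, s; split=> //; exact: ExecSkip.
- by move=> _ qs; do 2 eexists; split; [exact: ExecIStore|exact: leqnn|exact: qs].
- by move=> _ qs; do 2 eexists; split; [exact: ExecRStore|exact: leqnn|exact: qs].
- move=> /andP[sp sq] h; apply: wp_seq; apply: wp_weaken (IHp _ _ sp h) (leqnn _) _.
  by move=> s' /(IHq _ _ sq).
- move=> /andP[sp sq] [h1 h2]; apply: wp_if.
    by move=> /h1/(IHp _ _ sp)/wp_weaken; apply=> //; exact: leq_addr.
  by move=> /h2/(IHq _ _ sq)/wp_weaken; apply=> //; exact: leq_addl.
Qed.

Fixpoint iwrites p : seq nat :=
  match p with
  | CIStore a _ _ => [:: a]
  | CSeq p q | CIf _ p q => iwrites p ++ iwrites q
  | CWhile _ p => iwrites p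
  | _ => [::]
  end.

Fixpoint rwrites p : seq nat :=
  match p with
  | CRStore a _ _ => [:: a]
  | CSeq p q | CIf _ p q => rwrites p ++ rwrites q
  | CWhile _ p => rwrites p
  | _ => [::]
  end.

Definition framed p s s' : Prop :=
  (forall a, a \notin iwrites p -> imem s' a = imem s a) /\
  (forall a, a \notin rwrites p -> rmem s' a = rmem s a).

Lemma exec_framed p s t s' : exec p s t s' -> framed p s s'.
Proof.
elim=> {p s t s'} //.
- move=> a i e s; split=> //= b; rewrite inE => /negPf h; apply: funext => j.
  by rewrite /upd h.
- move=> a i e s; split=> //= b; rewrite inE => /negPf h; apply: funext => j.
  by rewrite /upd h.
- move=> p q s _ s1 _ s2 _ [i1 r1] _ [i2 r2].
  by split=> a /=; rewrite mem_cat negb_or => /andP[h1 h2]; rewrite ?i2 ?i1 ?r2 ?r1.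
- move=> b p q s _ s' _ _ [i1 r1].
  by split=> a /=; rewrite mem_cat negb_or => /andP[h1 h2]; rewrite ?i1 ?r1.
- move=> b p q s _ s' _ _ [i1 r1].
  by split=> a /=; rewrite mem_cat negb_or => /andP[h1 h2]; rewrite ?i1 ?r1.
- move=> b p s _ s1 _ s2 _ _ [i1 r1] _ [i2 r2].
  by split=> a /= h; rewrite ?i2 ?i1 ?r2 ?r1.
Qed.

Lemma wp_frame p s t Q : wp p s t Q -> wp p s t (fun s' => Q s' /\ framed p s s').
Proof.
by move=> [t' [s' [ex lt q]]]; exists t', s'; split=> //; split=> //; exact: exec_framed ex.
Qed.

Lemma wp_straight_framed p s t Q : straight p -> straight_cost p <= t ->
  straight_wp p s (fun s' => framed p s s' -> Q s') -> wp p s t Q.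
Proof.
by move=> sp lt h; apply: wp_weaken (wp_frame (wp_straight sp lt h)) _ _ => // s' [q /q].
Qed.

(** The body may be analysed knowing that arrays it never writes are as at loop entry, so invariants
    speak only of what changes. *)
Lemma wp_while_framed (Inv : nat -> state R -> Prop) b p t k s :
  (forall k s', framed p s s' -> Inv k s' -> beval s' b ->
     exists2 k', k' < k & wp p s' t (Inv k')) ->
  Inv k s ->
  wp (CWhile b p) s (k * (bcost b + t).+1 + (bcost b).+1)
    (fun s' => framed p s s' /\ exists2 k', Inv k' s' & ~~ beval s' b).
Proof.
move=> step inv; apply: wp_weaken
    (@wp_while (fun k s' => Inv k s' /\ framed p s s') b p t k s _ _) (leqnn _) _.
- move=> k1 s1 [inv1 fr1] hb; have [k' lt h] := step _ _ fr1 inv1 hb; exists k' => //.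
  apply: wp_weaken (wp_frame h) (leqnn _) _ => s2 [inv2 fr2]; split=> //.
  case: fr1 fr2 => [i1 r1] [i2 r2].
  by split=> a ha; rewrite ?i2 ?i1 ?r2 ?r1.
- by [].
- by move=> s' [k' [inv' fr] nb]; split=> //; exists k'.
Qed.

End Logic.

(** * Reading the input *)

(* Memory layout beyond the input and output arrays.
   Integer arrays: 4 = degrees in the remaining tree, 5 = sums of the indices of
   the remaining incident edges, 6 = degrees in the whole tree, and, for the k-th
   removed vertex, 7 = the vertex, 8 = its parent edge, 9 = its parent.
   Integer scalars, in cell 0: 10 = loop counter, 11 = number of removed vertices,
   12 = result of the last test, 13 = vertex examined for removal, 14 and 15 = its
   edge and parent, 24 = scanned vertex; 16 = width of the sorted blocks,
   17 = output position of the merge, 18 and 19 = its two input positions,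
   20 and 21 = their bounds; 22 and 23 = bounds of the binary search.
   Real arrays: 4 = tested edge vector, 6 = costs being sorted, 7 = merge buffer,
   8 = distances from the root, 9 = tested threshold. *)

Definition ivar a := ILoad a (IConst 0).
Definition iset a e := CIStore a (IConst 0) e.
Definition blt x y := BIle (IAdd x (IConst 1)) y.
Definition iincr a i e := CIStore a i (IAdd (ILoad a i) e).
Definition idecr a i e := CIStore a i (ISub (ILoad a i) e).

Declare Scope cmd_scope.
Local Notation "p ;; q" := (CSeq p q) (at level 60, right associativity) : cmd_scope.
Local Open Scope cmd_scope.

Local Notation vertex_count := (ILoad 0 (IConst 0)).
Local Notation edge_count := (ILoad 0 (IConst 1)).

Definition holds_input (R : realType) n m (I : instance R n m) (s : state R) : Prop :=
  (forall a, a < 3 -> imem s a = imem (input_state I) a) /\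
  (forall a, a < 4 -> rmem s a = rmem (input_state I) a).

Section Input.
Variables (R : realType) (n m : nat) (I : instance R n m).

Lemma holds_input_framed p s s' :
  all (leq 3) (iwrites p) -> all (leq 4) (rwrites p) ->
  framed p s s' -> holds_input I s -> holds_input I s'.
Proof.
move=> /allP hi /allP hr [fi fr] [ii ir]; split=> a lt.
  by rewrite fi ?ii //; apply/negP => /hi; rewrite leqNgt lt.
by rewrite fr ?ir //; apply/negP => /hr; rewrite leqNgt lt.
Qed.

Lemma mem_of_ord (A : Type) (x0 : A) (f : 'I_m -> A) (e : 'I_m) : mem_of x0 f e = f e.
Proof. by rewrite /mem_of valK. Qed.

Lemma inputE s : holds_input I s ->
  [/\ imem s 0 0 = n.+1, imem s 0 1 = m,
      forall e : 'I_m, imem s 1 e = (edges I e).1 &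
      forall e : 'I_m, imem s 2 e = (edges I e).2] /\
  [/\ rmem s 0 0 = D I, forall e : 'I_m, rmem s 1 e = w I e,
      forall e : 'I_m, rmem s 2 e = u I e &
      forall e : 'I_m, rmem s 3 e = c I e].
Proof.
move=> [hi hr]; split; split.
- by rewrite hi.
- by rewrite hi.
- by move=> e; rewrite hi //= mem_of_ord.
- by move=> e; rewrite hi //= mem_of_ord.
- by rewrite hr.
- by move=> e; rewrite hr //= mem_of_ord.
- by move=> e; rewrite hr //= mem_of_ord.
- by move=> e; rewrite hr //= mem_of_ord.
Qed.
End Input.

(* Rewrites a load from the current memory into loads from the initial one, in
   reverse order of the stores. *)
Ltac unwind :=
  repeat match goal with
  | e : ?g = upd _ _ _ _ |- context [?g] => rewrite e /upd /=
  end.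

(** The effect of one edge on both its endpoints: [d] is 1 for degrees and the edge index for index
    sums. *)
Lemma upd_incr2 (f : nat -> nat -> nat) a x y d v :
  let f1 := upd f a x (f a x + d) in
  upd f1 a y (f1 a y + d) a v = f a v + ((x == v) + (y == v)) * d.
Proof.
rewrite /upd !eqxx /= (eq_sym v) (eq_sym v).
have [<-|_] := eqVneq y v; have [->|_] := eqVneq; rewrite ?eqxx //; lia.
Qed.

Definition init_body :=
  iincr 4 (ILoad 1 (ivar 10)) (IConst 1) ;; iincr 4 (ILoad 2 (ivar 10)) (IConst 1) ;;
  iincr 5 (ILoad 1 (ivar 10)) (ivar 10) ;; iincr 5 (ILoad 2 (ivar 10)) (ivar 10) ;;
  iincr 6 (ILoad 1 (ivar 10)) (IConst 1) ;; iincr 6 (ILoad 2 (ivar 10)) (IConst 1) ;;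
  CRStore 6 (ivar 10) (RLoad 3 (ivar 10)) ;;
  iincr 10 (IConst 0) (IConst 1).
Definition init_loop := CWhile (blt (ivar 10) edge_count) init_body.

Section Init.
Variables (R : realType) (n m : nat) (I : instance R n m).

Lemma init_loopP s0 : holds_input I s0 -> (forall a i, 3 <= a -> imem s0 a i = 0) ->
  wp init_loop s0 (200 * m.+1) (fun s =>
  [/\ framed init_loop s0 s,
   forall v : 'I_n.+1, imem s 4 v = (\sum_e (((edges I e).1 == v) + ((edges I e).2 == v)))%N,
   forall v : 'I_n.+1, imem s 5 v =
     (\sum_(e < m) (((edges I e).1 == v) + ((edges I e).2 == v)) * e)%N,
   imem s 6 = imem s 4 &
   forall e : 'I_m, rmem s 6 e = c I e]).
Proof.
move=> inp0 z0.
pose inc v e := ((imem s0 1 e == v) + (imem s0 2 e == v))%N.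
pose Inv k (s : state R) := [/\ imem s 10 0 + k = m,
   forall v, imem s 4 v = (\sum_(0 <= e < imem s 10 0) inc v e)%N,
   forall v, imem s 5 v = (\sum_(0 <= e < imem s 10 0) inc v e * e)%N,
   forall v, imem s 6 v = imem s 4 v &
   forall e, e < imem s 10 0 -> rmem s 6 e = rmem s0 3 e].
apply: wp_weaken (@wp_while_framed _ Inv _ _ 150 m _ _ _) _ _.
- move=> k s fr [ik hd hs hl hc].
  have inp : holds_input I s by exact: holds_input_framed fr inp0.
  have [[_ mE _ _] _] := inputE inp.
  have f1 : imem s 1 = imem s0 1 by apply fr.
  have f2 : imem s 2 = imem s0 2 by apply fr.
  have f3 : rmem s 3 = rmem s0 3 by apply fr.
  rewrite /= mE addn1 => lt; exists k.-1; first by lia.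
  apply: wp_straight => //= g1 e1 g2 e2 g3 e3 g4 e4 g5 e5 g6 e6 r1 e7 g7 e8.
  have i7 : g7 10 0 = (imem s 10 0).+1 by unwind; rewrite addn1.
  have d7 v : g7 4 v = imem s 4 v + inc v (imem s 10 0).
    by rewrite /inc -f1 -f2 -[X in _ + X]muln1 -upd_incr2; unwind.
  rewrite /Inv /= i7; split; first lia.
  - by move=> v; rewrite big_nat_recr //= -hd d7.
  - by move=> v; rewrite big_nat_recr //= -hs /inc -f1 -f2 -upd_incr2; unwind.
  - by move=> v; rewrite d7 -hl /inc -f1 -f2 -[X in _ + X]muln1 -upd_incr2; unwind.
  - move=> e; rewrite ltnS leq_eqVlt => lt_e; unwind; rewrite f3.
    by case: eqVneq lt_e => [->//|_ /= /hc].
- split=> /=; rewrite ?z0 ?big_geq //= => v; rewrite !z0 ?big_geq //.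
- rewrite /=; lia.
- move=> s [fr [k [ik hd hs hl hc] /=]].
  have inp : holds_input I s by exact: holds_input_framed fr inp0.
  have [[_ mE _ _] _] := inputE inp.
  have [[_ _ aE bE] [_ _ _ cE]] := inputE inp0.
  rewrite mE => ge; have iE : imem s 10 0 = m by lia.
  split=> //.
  - move=> v; rewrite hd iE big_mkord; apply: eq_bigr => e _.
    by rewrite /inc aE bE.
  - move=> v; rewrite hs iE big_mkord; apply: eq_bigr => e _.
    by rewrite /inc aE bE.
  - exact/funext.
  - by move=> e; rewrite hc ?iE ?cE.
Qed.
End Init.

(** * Removal of leaves *)

(* After a removal only the parent can have become a leaf, so the walk climbs
   from the scanned vertex as long as it removes; with climbing and scanning as
   the two branches of one loop, every iteration removes or scans a vertex. *)
Definition prune_body :=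
  CIf (BAnd (BNot (BIeq (ivar 13) (IConst 0))) (BIeq (ILoad 4 (ivar 13)) (IConst 1)))
    (iset 14 (ILoad 5 (ivar 13)) ;;
     iset 15 (ISub (IAdd (ILoad 1 (ivar 14)) (ILoad 2 (ivar 14))) (ivar 13)) ;;
     CIStore 7 (ivar 11) (ivar 13) ;; CIStore 8 (ivar 11) (ivar 14) ;;
     CIStore 9 (ivar 11) (ivar 15) ;;
     idecr 4 (ivar 13) (IConst 1) ;; idecr 4 (ivar 15) (IConst 1) ;;
     idecr 5 (ivar 13) (ivar 14) ;; idecr 5 (ivar 15) (ivar 14) ;;
     iincr 11 (IConst 0) (IConst 1) ;; iset 13 (ivar 15))
    (iincr 24 (IConst 0) (IConst 1) ;; iset 13 (ivar 24)).
Definition prune_loop := CWhile (blt (ivar 24) vertex_count) prune_body.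

Section Prune.
Variables (R : realType) (n m : nat) (I : instance R n m).
Hypothesis validI : valid I.
Local Notation E := (edges I).
Let treeE : is_tree E. Proof. by case: validI. Qed.
Local Notation child := (child E).
Local Notation parent := (parent E).

Lemma incidence_sum (v : 'I_n.+1) (e : 'I_m) :
  (((E e).1 == v) + ((E e).2 == v) = (child e == v) + (parent e == v))%N.
Proof. by case: (child_parentE E e) => -> //=; rewrite addnC. Qed.

(** For a parent-closed [U], an edge has both ends in [U] as soon as its child end is there, so this
    counts incidences in the remaining tree. *)
Definition incidence (U : {set 'I_n.+1}) (v : 'I_n.+1) (e : 'I_m) : nat :=
  if child e \in U then (child e == v) + (parent e == v) else 0.

Definition parent_closed (U : {set 'I_n.+1}) :=
  forall e, child e \in U -> parent e \in U.

(** The edge from [v] to its parent already accounts for degree 1, so no other remaining edge meets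
    [v] and the index sum is the index of that edge. *)
Lemma remaining_leaf (U : {set 'I_n.+1}) v : parent_closed U -> v != root n ->
  \sum_e incidence U v e = 1 ->
  exists e, [/\ child e = v, v \in U, \sum_(e' < m) incidence U v e' * e' = e &
    forall e', child e' \in U -> parent e' != v].
Proof.
move=> clU vr deg1.
have vU : v \in U.
  apply/negPn/negP => vU; suff : \sum_e incidence U v e = 0 by rewrite deg1.
  rewrite big1 // => e _; rewrite /incidence; case: ifP => // eU.
  have [h|_] := eqVneq; first by rewrite -h eU in vU.
  by have [h|//] := eqVneq; move: vU; rewrite -h clU.
have [e ev] := child_surj treeE vr; exists e.
move/eqP: deg1; rewrite (bigD1 e) //= {1}/incidence ev vU eqxx add1n addSn eqSS addn_eq0 eqb0.
move=> /andP[/negPf pe]; rewrite sum_nat_eq0 => /forallP rest0.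
have inc0 e' : e' != e -> incidence U v e' = 0 by move/(implyP (rest0 e'))/eqP.
split=> //.
  rewrite (bigD1 e) //= {1}/incidence ev vU eqxx pe mul1n big1 ?addn0 // => e' /inc0->.
  by rewrite mul0n.
move=> e' e'U; have [->|/inc0] := eqVneq e' e; first by rewrite pe.
by rewrite /incidence e'U; case: (parent e' == v) => //; rewrite addn1.
Qed.

Lemma incidence_remove (U : {set 'I_n.+1}) e v (F : 'I_m -> nat) : child e \in U ->
  \sum_e' incidence U v e' * F e' =
  ((child e == v) + (parent e == v)) * F e + \sum_e' incidence (U :\ child e) v e' * F e'.
Proof.
move=> eU; rewrite (bigD1 e) //= [X in _ = _ + X](bigD1 e) //= {1 3}/incidence eU.
rewrite !inE eqxx /= mul0n add0n; congr (_ + _); apply: eq_bigr => e' ne.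
rewrite /incidence !inE (_ : child e' != child e) //.
by apply: contra ne => /eqP/(child_inj treeE)->.
Qed.

(* A deepest vertex among the remaining ones has no remaining child. *)
Lemma remaining_only_root (U : {set 'I_n.+1}) : parent_closed U -> root n \in U ->
  (forall v, v != root n -> \sum_e incidence U v e != 1) -> U = [set root n].
Proof.
move=> clU rU h; apply/setP => v; rewrite inE; apply/idP/eqP => [vU|->//].
apply/eqP/negPn/negP => vr.
have Pv : (v \in U) && (v != root n) by rewrite vU.
have [x /andP[xU xr] xmax] := @arg_maxnP _ v (fun v => (v \in U) && (v != root n)) (depth E) Pv.
have [e ex] := child_surj treeE xr; case/negP: (h _ xr).
rewrite (bigD1 e) //= {1}/incidence ex xU eqxx big1.
  rewrite (negPf (_ : parent e != x)) //.
  by rewrite -ex eq_sym; exact: child_neq_parent.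
move=> e' ne; rewrite /incidence; case: ifP => // e'U.
rewrite (negPf (_ : child e' != x)) /=; last first.
  by apply: contra ne; rewrite -ex => /eqP/(child_inj treeE)->.
apply/eqP; rewrite eqb0; apply/negP => /eqP px.
have := xmax (child e'); rewrite e'U child_neq_root // depth_child // px => /(_ isT) /=.
by rewrite ltnn.
Qed.

(** Every vertex is listed before its parent. The root is never listed, whence the alternative. *)
Definition bottom_up (len : nat) (ord ord_edge ord_parent : nat -> nat) : Prop :=
  (forall k, k < len -> exists e, [/\ ord k = child e, ord_edge k = e, ord_parent k = parent e &
     parent e = root n \/ exists2 k', k < k' < len & ord k' = parent e]) /\
  (forall e, exists2 k, k < len & ord k = child e).

Lemma upd_decr2 (f : nat -> nat -> nat) a x y d v : x != y ->
  let f1 := upd f a x (f a x - d) in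
  upd f1 a y (f1 a y - d) a v = f a v - ((x == v) + (y == v)) * d.
Proof.
rewrite /upd !eqxx /= => /negPf nxy; have [->|_] := eqVneq v y.
  by rewrite (eq_sym y x) nxy mul1n.
by have [->|_] := eqVneq v x; rewrite ?mul1n ?subn0.
Qed.

Lemma prune_loopP s0 : holds_input I s0 ->
  (forall v : 'I_n.+1, imem s0 4 v = \sum_e (((E e).1 == v) + ((E e).2 == v))) ->
  (forall v : 'I_n.+1, imem s0 5 v = \sum_(e < m) (((E e).1 == v) + ((E e).2 == v)) * e) ->
  imem s0 11 0 = 0 -> imem s0 13 0 = 0 -> imem s0 24 0 = 0 ->
  wp prune_loop s0 (400 * n.+1) (fun s =>
    framed prune_loop s0 s /\ bottom_up m (imem s 7) (imem s 8) (imem s 9)).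
Proof.
move=> inp0 deg0 sum0 K0 u0 v0.
(* [U] is the set of remaining vertices. The measure adds the vertices left to remove to those left
   to scan and starts at [2 * n.+1]. The last clause is the key: a remaining non-root leaf is either
   ahead of the scan or the vertex under examination. *)
pose Inv k (s : state R) := exists U : {set 'I_n.+1},
  [/\ k = #|U| + (n.+1 - imem s 24 0),
    (forall v : 'I_n.+1, imem s 4 v = \sum_e incidence U v e) /\
    (forall v : 'I_n.+1, imem s 5 v = \sum_(e < m) incidence U v e * e),
    parent_closed U /\ root n \in U,
    [/\ imem s 11 0 + #|U| = n.+1,
      forall k, k < imem s 11 0 -> exists e,
       [/\ imem s 7 k = child e, imem s 8 k = e, imem s 9 k = parent e &
         parent e \in U \/ exists2 k', k < k' < imem s 11 0 & imem s 7 k' = parent e] &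
      forall e, child e \notin U -> exists2 k, k < imem s 11 0 & imem s 7 k = child e] &
    [/\ (imem s 13 0 <= n) = (imem s 24 0 <= n), imem s 24 0 <= n.+1 &
      forall v : 'I_n.+1, v != root n -> imem s 4 v = 1 -> imem s 24 0 < v \/ v = imem s 13 0 :> nat]].
apply: wp_weaken (@wp_while_framed _ Inv _ _ 150 (2 * n.+1) _ _ _) _ _.
- move=> k s fr [U [kE [degE sumE] [clU rU] [KU ordE ordS] [uvE v_le cand]]].
  have inp : holds_input I s by exact: holds_input_framed fr inp0.
  have [[nE _ aE bE] _] := inputE inp.
  rewrite /= nE addn1 ltnS => v_lt; exists k.-1.
    suff : 0 < #|U| by lia.
    by apply/card_gt0P; exists (root n).
  apply: wp_straight => //=; split; last first.
    move=> nleaf g1 e1 g2 e2; exists U.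
    have g24 : g2 24 0 = (imem s 24 0).+1 by unwind; rewrite addn1.
    have g13 : g2 13 0 = (imem s 24 0).+1 by unwind; rewrite addn1.
    have g11 : g2 11 0 = imem s 11 0 by unwind.
    have gE a : a \in [:: 4; 5; 7; 8; 9] -> g2 a = imem s a.
      by rewrite !inE => /or4P[|||/orP[]] /eqP->; apply: funext => j; unwind.
    rewrite /= g24 g13 g11 !gE //; split=> //; first by rewrite kE subSS subSn // addnS.
    split=> //.
    move=> v vr dv; have [?|vu] := cand v vr dv; first lia.
    move: nleaf; rewrite -vu dv eqxx andbT negbK => /eqP v0'.
    by case/negP: vr; apply/eqP/val_inj.
  move=> /andP[unz /eqP deg1].
  have u_lt : imem s 13 0 < n.+1 by rewrite ltnS uvE.
  have [x xE] : exists x : 'I_n.+1, imem s 13 0 = x by exists (Ordinal u_lt).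
  rewrite xE in deg1 unz u_lt.
  have xr : x != root n by apply: contra unz => /eqP->.
  have [e [ex xU sume nochild]] := remaining_leaf clU xr (etrans (esym (degE x)) deg1).
  rewrite -sumE in sume.
  move=> g1 e1 g2 e2 g3 e3 g4 e4 g5 e5 g6 e6 g7 e7 g8 e8 g9 e9 g10 e10 g11 e11.
  (* The endpoints are stored in either order; subtracting one from their sum gives the other. *)
  have pE : imem s 1 e + imem s 2 e - x = parent e.
    rewrite aE bE -ex; case: (child_parentE E e) => -> /=; lia.
  have K11 : g11 11 0 = (imem s 11 0).+1 by unwind; rewrite addn1.
  have V11 : g11 24 0 = imem s 24 0 by unwind.
  have U11 : g11 13 0 = parent e by unwind; rewrite xE sume pE.
  have ordx j : g11 7 j = if j == imem s 11 0 then (x : nat) else imem s 7 j.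
    by unwind; rewrite xE.
  have orde j : g11 8 j = if j == imem s 11 0 then (e : nat) else imem s 8 j.
    by unwind; rewrite xE sume.
  have ordp j : g11 9 j = if j == imem s 11 0 then (parent e : nat) else imem s 9 j.
    by unwind; rewrite xE sume pE.
  have xp : (x : nat) != parent e by rewrite -ex; exact: child_neq_parent.
  have deg' (v : nat) : g11 4 v = imem s 4 v - ((x == v :> nat) + (parent e == v :> nat)).
    by rewrite -[X in _ - X]muln1 -upd_decr2 //; unwind; rewrite xE sume pE.
  have sum' (v : nat) : g11 5 v = imem s 5 v - ((x == v :> nat) + (parent e == v :> nat)) * e.
    by rewrite -upd_decr2 //; unwind; rewrite xE sume pE.
  have eU : child e \in U by rewrite ex.
  have deg'E (v : 'I_n.+1) : g11 4 v = \sum_e incidence (U :\ x) v e.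
    have := incidence_remove v (fun=> 1) eU.
    under eq_bigr do rewrite muln1; under [X in _ = _ + X]eq_bigr do rewrite muln1.
    by rewrite deg' degE ex muln1 => ->; rewrite addKn.
  have cardU : #|U| = (#|U :\ x|).+1 by rewrite (cardsD1 x) xU.
  exists (U :\ x); rewrite /= K11 V11 U11; split.
  - by rewrite kE cardU addSn.
  - split=> [v|v]; first exact: deg'E.
    by rewrite sum' sumE (incidence_remove v val eU) ex addKn.
  - split=> [e'|]; rewrite !inE; last by rewrite eq_sym xr.
    by move=> /andP[_ e'U]; rewrite nochild //= clU.
  - split=> [|j|e']; first by rewrite addSnnS -cardU.
      rewrite ltnS leq_eqVlt ordx orde ordp; case: eqVneq => [-> _|jK /= jlt].
        exists e; rewrite ex; split=> //; left.
        by rewrite !inE clU // andbT eq_sym.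
      have [e' [h1 h2 h3 h4]] := ordE _ jlt; exists e'; split=> //.
      (* A removed child of [x] now finds its parent at the position just filled. *)
      have [px|npx] := eqVneq (parent e') x.
        by right; exists (imem s 11 0); rewrite ?ordx ?eqxx ?px //; lia.
      case: h4 => [h4|[k' /andP[lt1 lt2] h4]]; first by left; rewrite !inE npx.
      by right; exists k'; rewrite ?ordx ?(ltn_eqF lt2) //; lia.
    rewrite !inE negb_and negbK => /orP[/eqP e'x|e'U].
      by exists (imem s 11 0); rewrite // ordx eqxx e'x.
    by have [j lt ej] := ordS _ e'U; exists j; [lia|rewrite ordx (ltn_eqF lt)].
  - split=> //; first by rewrite v_lt -ltnS ltn_ord.
    (* The only possible new leaf is the parent, which is examined next; [x] drops to degree 0. *)
    move=> v vr; rewrite deg'; have [->|nvp] := eqVneq v (parent e); first by right.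
    have [->|nvx] := eqVneq v x; first by rewrite deg1 eqxx; lia.
    have h1 : (x == v :> nat) = false by rewrite eq_sym; exact: negPf nvx.
    have h2 : (parent e == v :> nat) = false by rewrite eq_sym; exact: negPf nvp.
    rewrite h1 h2 subn0 => /(cand v vr)[|vx]; first by left.
    by case/eqP: nvx; apply: val_inj; rewrite /= vx xE.
- exists [set: 'I_n.+1]; rewrite v0 u0 K0 cardsT card_ord; split=> //.
  + lia.
  + split=> v; rewrite ?deg0 ?sum0; apply: eq_bigr => e _; rewrite incidence_sum.
      by rewrite /incidence inE.
    by rewrite /incidence inE.
  + split=> //; [by move=> e; rewrite !inE|by rewrite inE].
  + by split=> // e; rewrite inE.
  + split=> // v vr _; left; rewrite lt0n; apply: contra vr => /eqP h.
    exact/eqP/val_inj.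
- rewrite /=; lia.
- move=> s [fr [k [U [_ [degE _] [clU rU] [KU ordE ordS] [uvE v_le cand]]]]] /=.
  have inp : holds_input I s by exact: holds_input_framed fr inp0.
  have [[nE _ _ _] _] := inputE inp.
  rewrite nE addn1 ltnS -ltnNge => v_gt.
  have U1 : U = [set root n].
    apply: remaining_only_root => // v vr; apply/eqP; rewrite -degE => /(cand v vr).
    by have := ltn_ord v; lia.
  have Km : imem s 11 0 = m.
    by move: KU; rewrite U1 cards1 (tree_edge_count treeE); lia.
  rewrite Km in ordE ordS; split=> //; split=> [j /ordE[e [h1 h2 h3 h4]]|e].
    exists e; split=> //; case: h4 => h4; last by right.
    by left; move: h4; rewrite U1 inE => /eqP.
  by apply: ordS; rewrite U1 inE; exact: child_neq_root.
Qed.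
End Prune.

(** * Feasibility test *)

Definition fill_body :=
  CIf (BRle (RLoad 3 (ivar 10)) (RLoad 9 (IConst 0)))
    (CRStore 4 (ivar 10) (RLoad 2 (ivar 10)))
    (CRStore 4 (ivar 10) (RLoad 1 (ivar 10))) ;;
  iincr 10 (IConst 0) (IConst 1).
Definition fill :=
  iset 10 (IConst 0) ;; CWhile (blt (ivar 10) edge_count) fill_body.

(** The counter runs down, so the distance of the parent is already known. Only non-root vertices
    are visited, so degree 1 in array 6 means a leaf. *)
Definition check_body :=
  idecr 10 (IConst 0) (IConst 1) ;;
  CRStore 8 (ILoad 7 (ivar 10))
    (RAdd (RLoad 8 (ILoad 9 (ivar 10))) (RLoad 4 (ILoad 8 (ivar 10)))) ;;
  CIf (BAnd (BIeq (ILoad 6 (ILoad 7 (ivar 10))) (IConst 1))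
         (BNot (BRle (RLoad 0 (IConst 0)) (RLoad 8 (ILoad 7 (ivar 10))))))
    (iset 12 (IConst 0)) CSkip.
Definition check_init :=
  iset 12 (IConst 1) ;; CRStore 8 (IConst 0) (RConst 0) ;; iset 10 edge_count.
Definition check :=
  check_init ;; CWhile (blt (IConst 0) (ivar 10)) check_body.

Definition test := fill ;; check.

Section Test.
Variables (R : realType) (n m : nat) (I : instance R n m).
Hypothesis validI : valid I.
Local Notation E := (edges I).
Let treeE : is_tree E. Proof. by case: validI. Qed.
Local Notation child := (child E).
Local Notation parent := (parent E).

Lemma fillP s0 : holds_input I s0 -> wp fill s0 (100 * m.+1) (fun s =>
  framed fill s0 s /\ forall e : 'I_m, rmem s 4 e = raise_upto I (rmem s0 9 0) e).
Proof.
move=> inp0; suff h : wp fill s0 (100 * m.+1)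
    (fun s => forall e : 'I_m, rmem s 4 e = raise_upto I (rmem s0 9 0) e).
  by apply: wp_weaken (wp_frame h) _ _ => // s [].
apply: (@wp_seq_le _ _ _ _ 10 (90 * m.+1)); last lia.
apply: wp_straight_framed => //= g0 e0; set s1 := State _ _ => fr1.
have inp1 : holds_input I s1 by exact: holds_input_framed fr1 inp0.
pose Inv k (s : state R) := imem s 10 0 + k = m /\
  forall e : 'I_m, e < imem s 10 0 -> rmem s 4 e = raise_upto I (rmem s0 9 0) e.
apply: wp_weaken (@wp_while_framed _ Inv _ _ 60 m _ _ _) _ _.
- move=> k s fr [ik hf].
  have inp : holds_input I s by exact: holds_input_framed fr inp1.
  have [[_ mE _ _] [_ wE uE cE]] := inputE inp.
  have f9 : rmem s 9 = rmem s0 9 by rewrite fr.2 // fr1.2.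
  rewrite /= mE addn1 => lt; exists k.-1; first lia.
  have [e iE] : exists e : 'I_m, imem s 10 0 = e by exists (Ordinal lt).
  apply: wp_straight => //=; rewrite f9 iE cE uE wE.
  split=> cmp g1 e1 g2 e2; split=> /=; unwind; rewrite ?iE; try lia;
    move=> e'; rewrite addn1 ltnS leq_eqVlt; rewrite iE in hf.
  + case: eqVneq => [/val_inj-> _|_ /= /hf //]; first by rewrite /raise_upto cmp.
  + case: eqVneq => [/val_inj-> _|_ /= /hf //].
    by rewrite /raise_upto (negPf cmp).
- by rewrite /Inv /s1 /= e0 /upd /=.
- rewrite /=; lia.
- move=> s [fr [k [ik hf] /=]].
  have inp : holds_input I s by exact: holds_input_framed fr inp1.
  have [[_ mE _ _] _] := inputE inp.
  by rewrite mE => ge e; apply: hf; have := ltn_ord e; lia.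
Qed.

Local Open Scope ring_scope.

Lemma path_weight_root f : path_weight I f (root n) = 0.
Proof. by rewrite /path_weight path_edges_root // big_set0. Qed.

Lemma path_weight_child f e :
  path_weight I f (child e) = path_weight I f (parent e) + f e.
Proof.
rewrite /path_weight path_edges_child // big_setU1 /= 1?addrC //.
exact: path_edges_parent.
Qed.

Lemma checkP f s0 : holds_input I s0 ->
  bottom_up I m (imem s0 7) (imem s0 8) (imem s0 9) ->
  (forall v : 'I_n.+1, imem s0 6 v = \sum_e ((child e == v) + (parent e == v)))%N ->
  (forall e : 'I_m, rmem s0 4 e = f e) ->
  wp check s0 (100 * m.+1) (fun s => imem s 12 0 = reaches I f).
Proof.
move=> inp0 [ordE ordS] degE fE.
have leafP v : v != root n -> (v \in leaves E) = (imem s0 6 v == 1%N).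
  by move=> vr; rewrite leafE // vr degE.
apply: (@wp_seq_le _ _ _ _ 20 (80 * m.+1)); last lia.
apply: wp_straight_framed => //= g1 e1 g2 e2 g3 e3; set s1 := State _ _ => fr1.
have inp1 : holds_input I s1 by exact: holds_input_framed fr1 inp0.
(* The flag is never set back to 1, so once cleared it is justified by a fixed leaf that is too
   close to the root. *)
pose Inv k (s : state R) := [/\ imem s 10 0 = k, (k <= m)%N,
  forall v : 'I_n.+1, v = root n \/ (exists2 j, (k <= j < m)%N & imem s0 7 j = v) ->
    rmem s 8 v = path_weight I f v &
  (imem s 12 0 = 1%N /\ forall j e, (k <= j < m)%N -> imem s0 7 j = child e ->
    child e \in leaves E -> D I <= path_weight I f (child e)) \/
  (imem s 12 0 = 0%N /\ exists2 t, t \in leaves E & path_weight I f t < D I)].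
apply: wp_weaken (@wp_while_framed _ Inv _ _ 60 m _ _ _) _ _.
- move=> k s fr [iE km dist ok].
  have inp : holds_input I s by exact: holds_input_framed fr inp1.
  have [_ [DE _ _ _]] := inputE inp.
  have f4 : rmem s 4 = rmem s0 4 by rewrite fr.2 // fr1.2.
  have f6 : imem s 6 = imem s0 6 by rewrite fr.1 // fr1.1.
  have f7 : imem s 7 = imem s0 7 by rewrite fr.1 // fr1.1.
  have f8 : imem s 8 = imem s0 8 by rewrite fr.1 // fr1.1.
  have f9 : imem s 9 = imem s0 9 by rewrite fr.1 // fr1.1.
  case: k iE km dist ok => [|k] iE km dist ok; rewrite /= iE // => _; exists k => //.
  have [e [o1 o2 o3 o4]] := ordE k km.
  have distp : rmem s 8 (parent e) = path_weight I f (parent e).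
    by apply: dist; case: o4 => [->|[k' lt h]]; [left|right; exists k'; rewrite ?h //; lia].
  apply: wp_straight => //= h1 d1 h2 d2.
  have h10 : h1 10 0 = k by unwind; rewrite iE subn1.
  have h7 : h1 7 = imem s0 7 by rewrite d1 -f7; apply: funext.
  have h8 : h1 8 = imem s0 8 by rewrite d1 -f8; apply: funext.
  have h9 : h1 9 = imem s0 9 by rewrite d1 -f9; apply: funext.
  have h6 : h1 6 = imem s0 6 by rewrite d1 -f6; apply: funext.
  have h12 : h1 12 0 = imem s 12 0 by unwind.
  have d2' j : h2 8 j = if j == child e then path_weight I f (child e) else rmem s 8 j.
    by rewrite d2 /upd /= h10 h7 h8 h9 o1 o2 o3 distp f4 fE path_weight_child.
  have h0 : h2 0 0 = D I by rewrite d2 /upd /=.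
  rewrite h10 h6 h7 o1 h0 d2' eqxx -leafP ?child_neq_root //.
  have dist' (v : 'I_n.+1) : v = root n \/ (exists2 j, (k <= j < m)%N & imem s0 7 j = v) ->
      h2 8 v = path_weight I f v.
    rewrite d2'; case: eqVneq => [/val_inj->//|ne] hv; apply: dist.
    case: hv => [|[j /andP[kj jm] jv]]; [by left|right; exists j => //].
    move: kj; rewrite leq_eqVlt => /orP[/eqP kj|->//]; move: ne.
    by rewrite -jv -kj o1 eqxx.
  split=> [/andP[el nD] h3 d3|nbad]; rewrite /Inv /=.
    split=> //; first by rewrite d3 /upd /=.
      exact: ltnW.
    by right; rewrite d3 /upd /=; split=> //; exists (child e); rewrite ?ltNge.
  split=> //; first exact: ltnW.
  rewrite h12; case: ok => [[ok1 ok2]|]; [left; split=> //|by right].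
  move=> j e' /andP[kj jm] je'; move: kj; rewrite leq_eqVlt => /orP[/eqP kj|kj].
    move: je'; rewrite -kj o1 => /val_inj/(child_inj treeE) <- el.
    by move: nbad; rewrite el negbK.
  by apply: ok2 je'; rewrite kj.
- split.
  + rewrite /s1 /=; unwind.
    by have [[_ -> _ _] _] := inputE inp0.
  + by [].
  + move=> v [->|[j]]; last by lia.
    by rewrite /s1 /= e2 /upd /= path_weight_root.
  + by left; split=> [|j e]; [rewrite /s1 /=; unwind|lia].
- rewrite /=; lia.
- move=> s [fr [k [iE km dist ok] /=]]; rewrite iE => k0; have {}k0 : k = 0%N by lia.
  case: ok => -[-> ok]; last first.
    case: ok => t tl lt; apply/esym/eqP; rewrite eqb0; apply/negP => /reachesP/(_ t tl).
    by rewrite leNgt lt.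
  apply/esym/eqP; rewrite eqb1; apply/reachesP => t tl.
  have tr : t != root n by move: tl; rewrite inE => /andP[].
  have [e et] := child_surj treeE tr; have [j jm je] := ordS e.
  by rewrite -et; apply: (ok j) => //; rewrite ?et // k0.
Qed.

Lemma testP s0 : holds_input I s0 ->
  bottom_up I m (imem s0 7) (imem s0 8) (imem s0 9) ->
  (forall v : 'I_n.+1, imem s0 6 v = \sum_e ((child e == v) + (parent e == v)))%N ->
  wp test s0 (200 * m.+1) (fun s =>
    [/\ framed test s0 s, forall e : 'I_m, rmem s 4 e = raise_upto I (rmem s0 9 0%N) e &
        imem s 12 0 = reaches I (raise_upto I (rmem s0 9 0%N))]).
Proof.
move=> inp0 ord0 deg0.
suff h : wp test s0 (200 * m.+1) (fun s =>
    (forall e : 'I_m, rmem s 4 e = raise_upto I (rmem s0 9 0%N) e) /\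
    imem s 12 0 = reaches I (raise_upto I (rmem s0 9 0%N))).
  by apply: wp_weaken (wp_frame h) _ _ => // s [[]].
apply: (@wp_seq_le _ _ _ _ (100 * m.+1) (100 * m.+1)); last lia.
apply: wp_weaken (fillP inp0) _ _ => // s1 [fr1 f1].
have inp1 : holds_input I s1 by exact: holds_input_framed fr1 inp0.
apply: wp_weaken (wp_frame (checkP inp1 _ _ f1)) _ _ => //; rewrite ?fr1.1 //.
by move=> s [ok fr]; split=> // e; rewrite fr.2 // f1.
Qed.
End Test.

(** * Merge sort *)

Section Merge.
Variable R : realType.
Implicit Types A B : nat -> R.

Definition block_sorted (len d : nat) A : Prop :=
  forall o x y, d %| o -> o <= x -> x <= y -> y < o + d -> y < len -> (A x <= A y)%R.

(** Equality of ranges stands in for being a permutation: a threshold depends only on the set of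
    costs. *)
Definition covers (len : nat) A B (x : nat) : Prop := exists2 y, y < len & B y = A x.

Lemma block_offset_uniq d o o' k : d %| o -> d %| o' ->
  o <= k < o + d -> o' <= k < o' + d -> o = o'.
Proof.
move=> /dvdnP[q ->] /dvdnP[q' ->] h h'.
have d0 : 0 < d by lia.
have hq p : p * d <= k < p * d + d -> p = k %/ d.
  move=> /andP[h1 h2]; apply/eqP; rewrite eqn_leq leq_divRL // h1 /=.
  by rewrite -ltnS ltn_divLR // mulSn addnC.
by rewrite (hq q h) (hq q' h').
Qed.

Lemma block_sorted_extend d o k v B B' : d %| o -> o <= k < o + d ->
  block_sorted k d B -> (forall x, o <= x < k -> (B x <= v)%R) ->
  (forall x, B' x = if x == k then v else B x) -> block_sorted k.+1 d B'.
Proof.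
move=> od ok sB le_v B'E o' x y o'd o'x xy yo; rewrite ltnS leq_eqVlt !B'E.
case: (eqVneq y k) => [yk _|_ /= yk]; last first.
  by rewrite (ltn_eqF (leq_ltn_trans xy yk)); exact: (sB o').
case: (eqVneq x k) => [//|xk]; apply: le_v.
have -> : o = o' by apply: (block_offset_uniq od o'd ok); lia.
by lia.
Qed.

Variables (m W : nat) (A : nat -> R).
Hypothesis W_gt0 : 0 < W.
Hypothesis sortedA : block_sorted m W A.

Definition merged_upto k B : Prop :=
  [/\ k = m \/ W + W %| k, k <= m, block_sorted k (W + W) B,
      forall x, x < k -> covers k A B x & forall y, y < k -> exists2 x, x < m & A x = B y].

(* The block at offset [o] is being merged from [A[o, mid)] and [A[mid, stop)],
   read up to [i] and [j], into [B], written up to [k]. *)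
Definition merging o k i j mid stop B : Prop :=
  [/\ [/\ W + W %| o, o < m, mid = minn (o + W) m & stop = minn (o + W + W) m],
      [/\ o <= i <= mid, mid <= j <= stop & k + mid = i + j],
      block_sorted k (W + W) B,
      [/\ i < mid -> forall x, o <= x < k -> (B x <= A i)%R &
          j < stop -> forall x, o <= x < k -> (B x <= A j)%R] &
      (forall x, [|| x < o, o <= x < i | mid <= x < j] -> covers k A B x) /\
      (forall y, y < k -> exists2 x, x < m & A x = B y)].

Lemma merging_start k B : merged_upto k B -> k < m ->
  merging k k k (minn (k + W) m) (minn (k + W) m) (minn (k + W + W) m) B.
Proof.
move=> [[->|kW] km sB cov rng] lt; first by rewrite ltnn in lt.
split=> //; first by split; lia.
  by split=> _ x; lia.
by split=> // x h; apply: cov; lia.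
Qed.

Lemma merging_stop o k i j mid stop B :
  merging o k i j mid stop B -> k = stop -> merged_upto k B.
Proof.
move=> [[oW om midE stopE] [oi jstop kij] sB _ [cov rng]] kE.
split=> //; [|lia|by move=> x xk; apply: cov; lia].
have [->|ne] := eqVneq k m; [by left|right].
have -> : k = o + (W + W) by lia.
by rewrite dvdn_addr.
Qed.

Lemma covers_extend k v x B B' :
  (forall x, B' x = if x == k then v else B x) -> covers k A B x -> covers k.+1 A B' x.
Proof.
move=> B'E [y yk yE]; exists y; first lia.
by rewrite B'E (ltn_eqF yk).
Qed.

(** All entries written in this block stay below both heads: the new entry is below the next head of
    its own run by sortedness and below the other head by comparison. *)
Lemma merging_left o k i j mid stop B B' : merging o k i j mid stop B ->
  i < mid -> (j < stop -> (A i <= A j)%R) ->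
  (forall x, B' x = if x == k then A i else B x) ->
  merging o k.+1 i.+1 j mid stop B'.
Proof.
move=> [[oW om midE stopE] [oi jstop kij] sB [leAi leAj] [cov rng]] imid Aij B'E.
split=> //; first by split; lia.
- by apply: block_sorted_extend (leAi imid) B'E => //; lia.
- split=> lt x ox; rewrite B'E; case: eqVneq => xk.
  + by apply: (sortedA (o := o)); try lia; apply: dvdn_trans oW; rewrite addnn -muln2 dvdn_mulr.
  + apply: le_trans (leAi imid _ _) _; first lia.
    by apply: (sortedA (o := o)); try lia; apply: dvdn_trans oW; rewrite addnn -muln2 dvdn_mulr.
  + exact: Aij.
  + by apply: leAj => //; lia.
- split=> [x h|y yk].
    have [->|xi] := eqVneq x i; first by exists k => //; rewrite B'E eqxx.
    by apply: covers_extend B'E _; apply: cov; lia.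
  rewrite B'E; case: eqVneq => [_|ne]; first by exists i => //; lia.
  by apply: rng; lia.
Qed.

Lemma merging_right o k i j mid stop B B' : merging o k i j mid stop B ->
  j < stop -> (i < mid -> (A j <= A i)%R) ->
  (forall x, B' x = if x == k then A j else B x) ->
  merging o k.+1 i j.+1 mid stop B'.
Proof.
move=> [[oW om midE stopE] [oi jstop kij] sB [leAi leAj] [cov rng]] jlt Aji B'E.
have oW' : W %| o + W.
  by rewrite dvdn_addl //; apply: dvdn_trans oW; rewrite addnn -muln2 dvdn_mulr.
split=> //; first by split; lia.
- by apply: block_sorted_extend (leAj jlt) B'E => //; lia.
- split=> lt x ox; rewrite B'E; case: eqVneq => xk.
  + exact: Aji.
  + by apply: leAi => //; lia.
  + by apply: (sortedA (o := o + W)); lia.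
  + apply: le_trans (leAj jlt _ _) _; first lia.
    by apply: (sortedA (o := o + W)); lia.
- split=> [x h|y yk].
    have [->|xi] := eqVneq x j; first by exists k => //; rewrite B'E eqxx.
    by apply: covers_extend B'E _; apply: cov; lia.
  rewrite B'E; case: eqVneq => [_|ne]; first by exists j => //; lia.
  by apply: rng; lia.
Qed.
End Merge.

(** The minimum, because subtraction is truncated. *)
Definition imin x y := ISub x (ISub x y).

(** Opening a pair of blocks and merging share one loop, so each iteration writes one entry and a
    pass takes [m] iterations. As cell 21 starts at 0, the first iteration opens the first pair. *)
Definition pass_body :=
  CIf (BIle (ivar 21) (ivar 17))
    (iset 18 (ivar 17) ;;
     iset 20 (imin (IAdd (ivar 17) (ivar 16)) edge_count) ;;
     iset 19 (ivar 20) ;;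
     iset 21 (imin (IAdd (IAdd (ivar 17) (ivar 16)) (ivar 16)) edge_count))
    CSkip ;;
  CIf (BAnd (blt (ivar 18) (ivar 20))
         (BNot (BAnd (blt (ivar 19) (ivar 21))
                  (BNot (BRle (RLoad 6 (ivar 18)) (RLoad 6 (ivar 19)))))))
    (CRStore 7 (ivar 17) (RLoad 6 (ivar 18)) ;; iincr 18 (IConst 0) (IConst 1))
    (CRStore 7 (ivar 17) (RLoad 6 (ivar 19)) ;; iincr 19 (IConst 0) (IConst 1)) ;;
  iincr 17 (IConst 0) (IConst 1).
Definition pass :=
  (iset 17 (IConst 0) ;; iset 21 (IConst 0)) ;;
  CWhile (blt (ivar 17) edge_count) pass_body.

Definition copy_body :=
  CRStore 6 (ivar 10) (RLoad 7 (ivar 10)) ;; iincr 10 (IConst 0) (IConst 1).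
Definition copy :=
  iset 10 (IConst 0) ;; CWhile (blt (ivar 10) edge_count) copy_body.

Definition sort_body := pass ;; copy ;; iincr 16 (IConst 0) (ivar 16).
Definition sort_costs :=
  iset 16 (IConst 1) ;; CWhile (blt (ivar 16) edge_count) sort_body.

Section Sort.
Variables (R : realType) (n m : nat) (I : instance R n m).

Lemma passP s0 W : holds_input I s0 -> imem s0 16 0 = W -> 0 < W ->
  block_sorted m W (rmem s0 6) ->
  wp pass s0 (200 * m.+1) (fun s => merged_upto m W (rmem s0 6) m (rmem s 7)).
Proof.
move=> inp0 WE W_gt0 sA.
apply: (@wp_seq_le _ _ _ _ 20 (180 * m.+1)); last lia.
apply: wp_straight_framed => //= g1 e1 g2 e2; set s1 := State _ _ => fr1.
have inp1 : holds_input I s1 by exact: holds_input_framed fr1 inp0.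
pose A := rmem s0 6.
pose Inv fuel (s : state R) := [/\ imem s 17 0 + fuel = m &
  (imem s 21 0 <= imem s 17 0 /\ merged_upto m W A (imem s 17 0) (rmem s 7)) \/
  (imem s 17 0 < imem s 21 0 /\ exists o, merging m W A o (imem s 17 0) (imem s 18 0)
     (imem s 19 0) (imem s 20 0) (imem s 21 0) (rmem s 7))].
apply: wp_weaken (@wp_while_framed _ Inv _ _ 150 m _ _ _) _ _.
- move=> fuel s fr [kE inv].
  have inp : holds_input I s by exact: holds_input_framed fr inp1.
  have [[_ mE _ _] _] := inputE inp.
  have f16 : imem s 16 0 = W by rewrite fr.1 // fr1.1.
  have f6 : rmem s 6 = A by rewrite fr.2 // fr1.2.
  rewrite /= mE addn1 => lt; exists fuel.-1; first lia.
  pose Mid (s' : state R) := [/\ imem s' 17 0 = imem s 17 0, rmem s' 6 = A,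
    imem s' 17 0 < imem s' 21 0 & exists o, merging m W A o (imem s' 17 0) (imem s' 18 0)
     (imem s' 19 0) (imem s' 20 0) (imem s' 21 0) (rmem s' 7)].
  apply: (@wp_seq_le _ _ _ _ 60 90) => //.
  apply: (@wp_weaken _ _ _ 60 60 Mid) => //.
    apply: wp_straight => //=; split; last first.
      rewrite -ltnNge => lt2; case: inv => [[le _]|[_ inv]]; first lia.
      by split.
    move=> le; case: inv => [[_ inv]|[lt2 _]]; last lia.
    move=> h1 d1 h2 d2 h3 d3 h4 d4.
    have min2 x : x - (x - m) = minn x m by lia.
    have h17 : h4 17 0 = imem s 17 0 by unwind.
    have h18 : h4 18 0 = imem s 17 0 by unwind.
    have h20 : h4 20 0 = minn (imem s 17 0 + W) m by unwind; rewrite mE f16 min2.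
    have h19 : h4 19 0 = minn (imem s 17 0 + W) m by unwind; rewrite mE f16 min2.
    have h21 : h4 21 0 = minn (imem s 17 0 + W + W) m by unwind; rewrite mE f16 min2.
    rewrite /Mid /= h17 h18 h19 h20 h21; split=> //; first by lia.
    by exists (imem s 17 0); apply: merging_start.
  move=> s' [k'E A'E lt' [o mg]].
  apply: wp_straight => //=; rewrite A'E !addn1.
  have fin h : h 17 0 = (imem s' 17 0).+1 -> h 21 0 = imem s' 21 0 -> forall r,
      merging m W A o (imem s' 17 0).+1 (h 18 0) (h 19 0) (h 20 0) (imem s' 21 0) (r 7) ->
      Inv fuel.-1 (State h r).
    move=> h17 h21 r mg'; rewrite /Inv /= h17 h21; split; first lia.
    case: (leqP (imem s' 21 0) (imem s' 17 0).+1) => le; [left|right]; split=> //.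
      by apply: merging_stop mg' _; lia.
    by exists o.
  split=> cnd r1 c1 h1 d1 h2 d2; apply: fin; try by unwind; rewrite ?addn1.
  + have -> : h2 18 0 = (imem s' 18 0).+1 by unwind; rewrite ?addn1.
    have -> : h2 19 0 = imem s' 19 0 by unwind.
    have -> : h2 20 0 = imem s' 20 0 by unwind.
    move: cnd => /andP[imid nj]; apply: merging_left mg imid _ _ => //.
      by move=> lj; move: nj; rewrite lj /= negbK.
    by move=> x; rewrite c1 /upd.
  + have -> : h2 18 0 = imem s' 18 0 by unwind.
    have -> : h2 19 0 = (imem s' 19 0).+1 by unwind; rewrite ?addn1.
    have -> : h2 20 0 = imem s' 20 0 by unwind.
    (* Were the right run exhausted, the failed condition would exhaust the left one too, and the
       output block would already be full. *)
    have jlt : imem s' 19 0 < imem s' 21 0.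
      rewrite ltnNge; apply/negP => ge; move: cnd; rewrite [_ < imem s' 21 0]ltnNge ge /= andbT.
      case: mg => [_ [h3 h4 h5] _ _ _]; lia.
    apply: merging_right mg (jlt) _ _ => //.
      by move=> li; move: cnd; rewrite li jlt /= negbK -ltNge => /ltW.
    by move=> x; rewrite c1 /upd.
- rewrite /Inv /s1 /=; unwind; split=> //; left; split=> //.
  by split=> //; right; exact: dvdn0.
- rewrite /=; lia.
- move=> s [fr [fuel [kE inv] /=]].
  have inp : holds_input I s by exact: holds_input_framed fr inp1.
  have [[_ mE _ _] _] := inputE inp.
  rewrite mE addn1 -leqNgt => ge; have kE' : imem s 17 0 = m by lia.
  case: inv; rewrite kE'; first by case.
  by case=> lt [o [[_ _ _ sE] _ _ _ _]]; lia.
Qed.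

Lemma copyP s0 : holds_input I s0 ->
  wp copy s0 (100 * m.+1) (fun s => forall x, x < m -> rmem s 6 x = rmem s0 7 x).
Proof.
move=> inp0; apply: (@wp_seq_le _ _ _ _ 10 (90 * m.+1)); last lia.
apply: wp_straight_framed => //= g1 e1; set s1 := State _ _ => fr1.
have inp1 : holds_input I s1 by exact: holds_input_framed fr1 inp0.
pose Inv k (s : state R) := imem s 10 0 + k = m /\
  forall x, x < imem s 10 0 -> rmem s 6 x = rmem s0 7 x.
apply: wp_weaken (@wp_while_framed _ Inv _ _ 60 m _ _ _) _ _.
- move=> k s fr [ik hf].
  have inp : holds_input I s by exact: holds_input_framed fr inp1.
  have [[_ mE _ _] _] := inputE inp.
  have f7 : rmem s 7 = rmem s0 7 by rewrite fr.2 // fr1.2.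
  rewrite /= mE addn1 => lt; exists k.-1; first lia.
  apply: wp_straight => //= r1 d1 h1 d2; split=> /=; unwind; first lia.
  move=> x; rewrite addn1 ltnS leq_eqVlt f7; case: eqVneq => [->//|_ /= /hf //].
- by rewrite /Inv /s1 /=; unwind.
- rewrite /=; lia.
- move=> s [fr [k [ik hf] /=]].
  have inp : holds_input I s by exact: holds_input_framed fr inp1.
  have [[_ mE _ _] _] := inputE inp.
  by rewrite mE => ge x xm; apply: hf; lia.
Qed.

Lemma sort_costsP s0 : holds_input I s0 -> (forall e : 'I_m, rmem s0 6 e = c I e) ->
  wp sort_costs s0 (400 * (m.+1 * (trunc_log 2 m).+2)) (fun s =>
    [/\ framed sort_costs s0 s, forall x y, x <= y < m -> (rmem s 6 x <= rmem s 6 y)%R,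
        forall e, exists2 x, x < m & rmem s 6 x = c I e &
        forall x, x < m -> exists e, rmem s 6 x = c I e]).
Proof.
move=> inp0 cE.
suff h : wp sort_costs s0 (400 * (m.+1 * (trunc_log 2 m).+2)) (fun s =>
    [/\ forall x y, x <= y < m -> (rmem s 6 x <= rmem s 6 y)%R,
        forall e, exists2 x, x < m & rmem s 6 x = c I e &
        forall x, x < m -> exists e, rmem s 6 x = c I e]).
  by apply: wp_weaken (wp_frame h) _ _ => // s [[]].
(* Starting from width 1, [L] doublings exceed [m]. *)
pose L := (trunc_log 2 m).+1.
have mL : m < 2 ^ L by exact: trunc_log_ltn.
apply: (@wp_seq_le _ _ _ _ 10 (L * (400 * m.+1) + 10)); last by rewrite -/L; nia.
apply: wp_straight_framed => //= g1 e1; set s1 := State _ _ => fr1.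
have inp1 : holds_input I s1 by exact: holds_input_framed fr1 inp0.
pose Inv k (s : state R) := [/\ 0 < imem s 16 0, m <= imem s 16 0 * 2 ^ k,
  block_sorted m (imem s 16 0) (rmem s 6),
  forall e, exists2 x, x < m & rmem s 6 x = c I e &
  forall x, x < m -> exists e, rmem s 6 x = c I e].
apply: wp_weaken (@wp_while_framed _ Inv _ _ (300 * m.+1 + 20) L _ _ _) _ _.
- move=> k s fr [W_gt0 mW sA covA rngA].
  have inp : holds_input I s by exact: holds_input_framed fr inp1.
  have [[_ mE _ _] _] := inputE inp.
  rewrite /= mE addn1 => lt.
  case: k mW => [|k] mW; first by lia.
  exists k => //.
  apply: (@wp_seq_le _ _ _ _ (200 * m.+1) (100 * m.+1 + 20)); last lia.
  apply: wp_weaken (wp_frame (passP inp _ W_gt0 sA)) _ _ => // s2 [[_ _ sB covB rngB] fr2].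
  have inp2 : holds_input I s2 by exact: holds_input_framed fr2 inp.
  apply: (@wp_seq_le _ _ _ _ (100 * m.+1) 20); last lia.
  apply: wp_weaken (wp_frame (copyP inp2)) _ _ => // s3 [cp fr3].
  apply: wp_straight => //= h1 d1; rewrite /Inv /=.
  have -> : h1 16 0 = imem s 16 0 + imem s 16 0 by unwind; rewrite fr3.1 // fr2.1.
  split=> //.
  + lia.
  + by move: mW; rewrite expnS; nia.
  + by move=> o x y od ox xy yo ym; rewrite !cp //; [exact: (sB o)|exact: leq_ltn_trans ym].
  + move=> e; have [x xm <-] := covA e; have [y ym <-] := covB x xm.
    by exists y => //; rewrite cp.
  + by move=> x xm; rewrite cp //; have [y ym <-] := rngB x xm; exact: rngA.
- rewrite /Inv /s1 /=; unwind; split=> //.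
  + lia.
  + move=> o x y _ ox xy yo _; have -> : x = y by lia.
    exact: lexx.
  + by move=> e; exists e.
  + by move=> x xm; exists (Ordinal xm); rewrite -cE.
- rewrite /=; nia.
- move=> s [fr [k [W_gt0 _ sA covA rngA] /=]].
  have inp : holds_input I s by exact: holds_input_framed fr inp1.
  have [[_ mE _ _] _] := inputE inp.
  rewrite mE => ge; split=> // x y /andP[xy ym].
  (* The width is now at least [m], so the block at offset 0 is the whole array. *)
  by apply: (sA 0) => //; lia.
Qed.
End Sort.

(** * The program *)

Definition midpoint := IHalf (IAdd (ivar 22) (ivar 23)).
Definition search_body :=
  CRStore 9 (IConst 0) (RLoad 6 midpoint) ;; test ;;
  CIf (BIeq (ivar 12) (IConst 1)) (iset 23 midpoint) (iset 22 (IAdd midpoint (IConst 1))).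
Definition search :=
  (iset 22 (IConst 0) ;; iset 23 edge_count) ;;
  CWhile (blt (ivar 22) (ivar 23)) search_body.
(** Position [m] is a sentinel for infeasibility: ending there leaves the flag 0. Otherwise [test]
    is run again, since the last vector tried by the search may belong to another threshold. *)
Definition finish :=
  CIf (blt (ivar 22) edge_count)
    (CRStore 9 (IConst 0) (RLoad 6 (ivar 22)) ;; test ;;
     iset 3 (IConst 1) ;; CRStore 5 (IConst 0) (RLoad 9 (IConst 0)))
    CSkip.
Definition solve :=
  init_loop ;; prune_loop ;; sort_costs ;;
  CRStore 9 (IConst 0) (RConst 0) ;; test ;;
  CIf (BIeq (ivar 12) (IConst 1))
    (iset 3 (IConst 1) ;; CRStore 5 (IConst 0) (RConst 0))
    (search ;; finish).

Section Solve.
Variables (R : realType) (n m : nat) (I : instance R n m).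
Hypothesis validI : valid I.
Local Notation E := (edges I).
Let treeE : is_tree E. Proof. by case: validI. Qed.
Local Notation child := (child E).
Local Notation parent := (parent E).

Record ready (s : state R) : Prop := Ready {
  ready_input : holds_input I s;
  ready_order : bottom_up I m (imem s 7) (imem s 8) (imem s 9);
  ready_degree : forall v : 'I_n.+1, imem s 6 v = \sum_e ((child e == v) + (parent e == v));
  ready_sorted : forall x y, x <= y < m -> (rmem s 6 x <= rmem s 6 y)%R;
  ready_cover : forall e, exists2 x, x < m & rmem s 6 x = c I e;
  ready_range : forall x, x < m -> exists e, rmem s 6 x = c I e }.

Lemma ready_framed p s s' :
  all (fun a => (3 <= a) && (a \notin [:: 6; 7; 8; 9])) (iwrites p) ->
  all (fun a => (4 <= a) && (a != 6)) (rwrites p) ->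
  framed p s s' -> ready s -> ready s'.
Proof.
move=> hi hr fr [inp ord deg srt cov rng].
have ni a : a \in [:: 6; 7; 8; 9] -> a \notin iwrites p.
  by move=> ha; apply/negP => /(allP hi); rewrite ha andbF.
have nr : 6 \notin rwrites p by apply/negP => /(allP hr).
have inp' : holds_input I s'.
  by apply: holds_input_framed fr inp; [apply: sub_all hi|apply: sub_all hr] => a /andP[].
by split; rewrite ?fr.1 ?fr.2 ?ni.
Qed.

Lemma test_readyP s0 : ready s0 -> wp test s0 (200 * m.+1) (fun s =>
  [/\ ready s, framed test s0 s, forall e : 'I_m, rmem s 4 e = raise_upto I (rmem s0 9 0) e &
      imem s 12 0 = reaches I (raise_upto I (rmem s0 9 0))]).
Proof.
move=> rd; have [inp ord deg _ _ _] := rd.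
apply: wp_weaken (testP validI inp ord deg) _ _ => // s [fr h1 h2]; split=> //.
exact: ready_framed fr rd.
Qed.

Lemma searchP s0 : ready s0 -> wp search s0 (300 * (m.+1 * (trunc_log 2 m).+2)) (fun s =>
  [/\ ready s, framed search s0 s, imem s 22 0 <= m,
      forall x, x < imem s 22 0 -> ~~ reaches I (raise_upto I (rmem s 6 x)) &
      imem s 22 0 < m -> reaches I (raise_upto I (rmem s 6 (imem s 22 0)))]).
Proof.
move=> rd0.
suff h : wp search s0 (300 * (m.+1 * (trunc_log 2 m).+2)) (fun s =>
  [/\ imem s 22 0 <= m,
      forall x, x < imem s 22 0 -> ~~ reaches I (raise_upto I (rmem s0 6 x)) &
      imem s 22 0 < m -> reaches I (raise_upto I (rmem s0 6 (imem s 22 0)))]).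
  apply: wp_weaken (wp_frame h) _ _ => // s [[h1 h2 h3] fr]; split; rewrite ?fr.2 //.
  exact: ready_framed fr rd0.
pose L := (trunc_log 2 m).+1.
have mL : m < 2 ^ L by exact: trunc_log_ltn.
apply: (@wp_seq_le _ _ _ _ 20 (L * (280 * m.+1) + 10)); last by rewrite -/L; nia.
apply: wp_straight_framed => //= g1 e1 g2 e2; set s1 := State _ _ => fr1.
have rd1 : ready s1 by exact: ready_framed fr1 rd0.
pose P x := reaches I (raise_upto I (rmem s0 6 x)).
(* At the sentinel [m] nothing is claimed about the upper end. The strict bound by [2 ^ k] forces an
   empty interval at [k = 0]. *)
pose Inv k (s : state R) := [/\ imem s 22 0 <= imem s 23 0 <= m,
  imem s 23 0 - imem s 22 0 < 2 ^ k, forall x, x < imem s 22 0 -> ~~ P x &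
  imem s 23 0 < m -> P (imem s 23 0)].
apply: wp_weaken (@wp_while_framed _ Inv _ _ (200 * m.+1 + 60) L _ _ _) _ _.
- move=> k s fr [lohi hik nP hP] /=; rewrite addn1 => lt.
  have rd : ready s by exact: ready_framed fr rd1.
  have f6 : rmem s 6 = rmem s0 6 by rewrite fr.2 // fr1.2.
  case: k hik => [|k] hik; first by lia.
  rewrite expnS in hik; exists k => //.
  apply: (@wp_seq_le _ _ _ _ 20 (200 * m.+1 + 40)); last lia.
  apply: wp_straight_framed => //= r1 d1; set s2 := State _ _ => fr2.
  have rd2 : ready s2 by exact: ready_framed fr2 rd.
  apply: (@wp_seq_le _ _ _ _ (200 * m.+1) 40); last lia.
  apply: wp_weaken (test_readyP rd2) _ _ => // s3 [rd3 fr3 _].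
  have -> : rmem s2 9 0 = rmem s0 6 (imem s 22 0 + imem s 23 0)./2.
    by rewrite /s2 /=; unwind; rewrite f6.
  have f22 : imem s3 22 0 = imem s 22 0 by rewrite fr3.1.
  have f23 : imem s3 23 0 = imem s 23 0 by rewrite fr3.1.
  rewrite -/(P _) => okE; apply: wp_straight => //=; rewrite okE f22 f23 eqb1.
  split=> Pm h1 d3; rewrite /Inv /=.
    have -> : h1 22 0 = imem s 22 0 by unwind.
    have -> : h1 23 0 = (imem s 22 0 + imem s 23 0)./2 by unwind.
    by split=> //; lia.
  have -> : h1 22 0 = (imem s 22 0 + imem s 23 0)./2.+1 by unwind; rewrite addn1.
  have -> : h1 23 0 = imem s 23 0 by unwind.
  split=> //; try lia.
  move=> x xlt; apply: contra Pm; apply: reaches_raise_mono => //.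
  by apply: (ready_sorted rd0); lia.
- have [[_ mE _ _] _] := inputE (ready_input rd0).
  rewrite /Inv /s1 /=; unwind; by rewrite mE ltnn leqnn subn0; split.
- rewrite /=; nia.
- move=> s [fr [k [lohi _ nP hP] /=]] ge.
  have -> : imem s 22 0 = imem s 23 0 by lia.
  split=> //; first lia.
  by move=> x xlt; apply: nP; lia.
Qed.

Lemma algorithm2_threshold C : threshold I C -> algorithm2 I = Some (raise_upto I C, C).
Proof.
move=> thC; have [nw [e eC] rC _] := thC.
case: (algorithm2P validI) => [[rw _]|[_ nr _]|[C' thC' ->]].
- by rewrite rw in nw.
- by have := nr e; rewrite -eC rC.
- by rewrite (threshold_uniq thC thC').
Qed.

Lemma algorithm2_infeasible : ~~ reaches I (w I) ->
  (forall e, ~~ reaches I (raise_upto I (c I e))) -> algorithm2 I = None.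
Proof.
move=> nw nr; case: (algorithm2P validI) => [[rw _]|[_ _ //]|[C [_ [e ->] rC _] _]].
- by rewrite rw in nw.
- by have := nr e; rewrite rC.
Qed.

Lemma search_finishP s0 : ready s0 -> ~~ reaches I (w I) -> imem s0 3 0 = 0 ->
  wp (search ;; finish) s0 (600 * (m.+1 * (trunc_log 2 m).+2)) (fun s => output_in s (algorithm2 I)).
Proof.
move=> rd0 nw fl0.
apply: (@wp_seq_le _ _ _ _ (300 * (m.+1 * (trunc_log 2 m).+2)) (200 * m.+1 + 60)); last by nia.
apply: wp_weaken (searchP rd0) _ _ => // s1 [rd1 fr1 lom nP yP].
have [[_ mE _ _] _] := inputE (ready_input rd1).
have bound : (bcost (blt (ivar 22) edge_count) + (200 * m.+1 + 40)).+1 <= 200 * m.+1 + 60.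
  by rewrite /=; lia.
apply: wp_weaken (wp_if (t := 200 * m.+1 + 40) _ _) bound (fun s h => h) => /=; rewrite mE addn1.
  move=> lt; apply: (@wp_seq_le _ _ _ _ 10 (200 * m.+1 + 30)); last lia.
  apply: wp_straight_framed => //= r1 d1; set s2 := State _ _ => fr2.
  have rd2 : ready s2 by exact: ready_framed fr2 rd1.
  apply: (@wp_seq_le _ _ _ _ (200 * m.+1) 30); last lia.
  apply: wp_weaken (test_readyP rd2) _ _ => // s3 [rd3 fr3 f3 _].
  have C2 : rmem s2 9 0 = rmem s1 6 (imem s1 22 0) by rewrite /s2 /=; unwind.
  have C3 : rmem s3 9 0 = rmem s2 9 0 by rewrite fr3.2.
  set C := rmem s1 6 (imem s1 22 0) in C2 *.
  have thC : threshold I C.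
    split=> //; [exact: ready_range|exact: yP|].
    move=> e; have [x xm <-] := ready_cover rd1 e => xC; apply: nP.
    rewrite ltnNge; apply: contraL xC => xlo; rewrite -leNgt; apply: ready_sorted rd1 _ _ _.
    by rewrite xlo xm.
  rewrite (algorithm2_threshold thC); apply: wp_straight => //= h1 d3 r2 d4.
  split=> /=; [by unwind|move=> e|by unwind; rewrite C3 C2].
  by unwind; rewrite f3 C2.
move=> ge; rewrite algorithm2_infeasible //.
  by apply: wp_straight => //=; rewrite fr1.1.
by move=> e; have [x xm <-] := ready_cover rd1 e; apply: nP; lia.
Qed.

Lemma solveP : wp solve (input_state I) (2000 * (n.+1 * (trunc_log 2 n.+1).+2))
  (fun s => output_in s (algorithm2 I)).
Proof.
have mn : m = n := tree_edge_count treeE.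
(* A common unit of time: by [TE] it also absorbs the linear phases. *)
pose T := m.+1 * (trunc_log 2 m).+2.
have TE : m.+1 * 2 <= T by rewrite leq_mul2l.
have T_le : T <= n.+1 * (trunc_log 2 n.+1).+2.
  by rewrite /T mn leq_mul2l !ltnS leq_trunc_log ?leqnSn ?orbT.
set s0 := input_state I.
have inp0 : holds_input I s0 by [].
apply: (@wp_seq_le _ _ _ _ (200 * m.+1) (1800 * T)); last by move: T_le; lia.
apply: wp_weaken (init_loopP inp0 _) _ _ => //; first by move=> [|[|[|a]]].
move=> s1 [fr1 deg1 sum1 cp1 cost1].
have inp1 : holds_input I s1 by exact: holds_input_framed fr1 inp0.
apply: (@wp_seq_le _ _ _ _ (400 * n.+1) (1500 * T)); last by move: TE; rewrite -mn; lia.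
apply: wp_weaken (prune_loopP validI inp1 deg1 sum1 _ _ _) _ _ => //; rewrite ?fr1.1 //.
move=> s2 [fr2 ord2].
have inp2 : holds_input I s2 by exact: holds_input_framed fr2 inp1.
apply: (@wp_seq_le _ _ _ _ (400 * T) (1000 * T)); last lia.
apply: wp_weaken (sort_costsP inp2 _) _ _ => //; first by move=> e; rewrite fr2.2.
move=> s3 [fr3 srt cov rng].
have rd3 : ready s3.
  split=> //; first exact: holds_input_framed fr3 inp2.
    by rewrite !fr3.1.
  move=> v; rewrite fr3.1 // fr2.1 // cp1 deg1; apply: eq_bigr => e _.
  exact: incidence_sum.
apply: (@wp_seq_le _ _ _ _ 10 (900 * T)); last by move: TE; lia.
apply: wp_straight_framed => //= r1 d1; set s4 := State _ _ => fr4.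
have rd4 : ready s4 by exact: ready_framed fr4 rd3.
have C4 : rmem s4 9 0 = 0%R by rewrite /s4 /=; unwind.
apply: (@wp_seq_le _ _ _ _ (200 * m.+1) (700 * T)); last by move: TE; lia.
apply: wp_weaken (test_readyP rd4) _ _ => // s5 [rd5 fr5].
rewrite C4 (eq_reaches I (raise_upto0 validI)) => f5 ok5.
have bound : (bcost (BIeq (ivar 12) (IConst 1)) + 600 * T).+1 <= 700 * T.
  by rewrite /=; move: TE; lia.
apply: wp_weaken (wp_if (t := 600 * T) _ _) bound (fun s h => h) => /=; rewrite ok5 eqb1.
  move=> rw; have -> : algorithm2 I = Some (w I, 0%R) by rewrite /algorithm2 rw.
  apply: wp_straight => //=; first by move: TE; lia.
  move=> h1 d3 r2 d4; split=> /=; [by unwind|move=> e|by unwind].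
  by unwind; rewrite f5 raise_upto0.
move=> nw; apply: search_finishP => //.
by rewrite fr5.1 // fr4.1 // fr3.1 // fr2.1 // fr1.1.
Qed.
End Solve.

Lemma nlogn_bound : is_O_nlogn (fun N => 2000 * (N * (trunc_log 2 N).+2)).
Proof.
(* For [N >= 2] the logarithm [l] is at least 1, so [l + 2 <= 3 * l], and 6000 is [2000 * 3]. *)
exists 6000, 2 => N N2.
have : 0 < trunc_log 2 N by rewrite trunc_log_gt0.
move: (trunc_log 2 N) => l l0; rewrite -[6000]/(2000 * 3) -mulnA leq_mul2l /=.
by rewrite mulnCA leq_mul2l; apply/orP; right; lia.
Qed.

Theorem theorem9 (R : realType) :
  exists (p : cmd) (T : nat -> nat),
    is_O_nlogn T /\
    forall (n m : nat) (I : instance R n m), valid I ->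
      correct I (algorithm2 I) /\
      exists (t : nat) (s : state R),
        [/\ exec p (input_state I) t s,
            (t <= T n.+1)%N
          & output_in s (algorithm2 I)].
Proof.
exists solve, (fun N => 2000 * (N * (trunc_log 2 N).+2)); split; first exact: nlogn_bound.
move=> n m I validI; split; [exact: algorithm2_correct|exact: solveP].
Qed.
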